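(* For every family of positive numbers $\{a_x:x>0\}$ such that $$a_x\to 0\quad\text{and}\quad xa_x\to\infty\qquad(\text{as }x\to\infty),$$ the family of $\mathbb{R}^2$-valued random variables $$\left\{\sqrt{xa_x}\left(\frac{\tau(x)}{x}-\varphi^\prime(0),\ \frac{A(x)}{x^2}-\frac{1}{2}\varphi^\prime(0)\right):x>0\right\}$$ satisfies the large deviation principle (as $x\to\infty$) with speed $1/a_x$ and good rate function $\Psi_\Lambda^*$ defined by $$\Psi_\Lambda^*(z_1,z_2)=\frac{1}{2}\sum_{i,j=1}^2\hat{c}_{ij}z_iz_j,$$ where $$(\hat{c}_{ij})_{i,j\in\{1,2\}}=\frac{1}{\varphi^{\prime\prime}(0)}\begin{pmatrix}4&-6\\-6&12\end{pmatrix}$$ is the inverse of the matrix $C=\varphi^{\prime\prime}(0)\begin{pmatrix}1&1/2\\1/2&1/3\end{pmatrix}$.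
   Context: Let $\{T_n:n\geq 1\}$ be i.i.d. (strictly) positive random variables on a probability space $(\Omega,\mathcal{F},P)$, and define $\varphi:\mathbb{R}\to(-\infty,\infty]$ by $\mathbb{E}[e^{\alpha T_n}]=e^{\varphi(\alpha)}$. It is assumed throughout that $0$ belongs to the interior of $\mathcal{D}(\varphi):=\{\alpha\in\mathbb{R}:\varphi(\alpha)<\infty\}$, so that $\varphi$ is smooth near $0$; it is also assumed that $\varphi^{\prime\prime}(0)>0$ (i.e. $T_1$ is not almost surely constant). Let $N(t):=\sum_{n\geq 1}1_{\{T_1+\cdots+T_n\leq t\}}$, $t\geq 0$, be the associated renewal process. For real $x>0$ define $$\tau(x):=\inf\{t\geq 0:x-N(t)\leq 0\},\qquad A(x):=\int_0^{\tau(x)}(x-N(t))\,dt.$$ Limits as $x\to\infty$ are taken over real $x>0$. A rate function on $\mathbb{R}^h$ is a lower semi-continuous function $I:\mathbb{R}^h\to[0,\infty]$; it is good if all its level sets $\{z\in\mathbb{R}^h:I(z)\leq\eta\}$, $\eta\geq 0$, are compact. A family of $\mathbb{R}^h$-valued random variables $\{Z_x:x>0\}$ satisfies the large deviation principle with speed $v_x\to\infty$ and rate function $I$ if $$\limsup_{x\to\infty}\frac{1}{v_x}\log P(Z_x\in C)\leq-\inf_{z\in C}I(z)\ \text{ for all closed sets }C,$$ $$\liminf_{x\to\infty}\frac{1}{v_x}\log P(Z_x\in O)\geq-\inf_{z\in O}I(z)\ \text{ for all open sets }O.$$ *)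

(* Defs.v *)
From HB Require Import structures.
From mathcomp Require Import all_boot all_order all_algebra finmap.
From mathcomp Require Import all_classical all_reals all_analysis.
Set Implicit Arguments.
Unset Strict Implicit.
Unset Printing Implicit Defensive.
Import Order.TTheory GRing.Theory Num.Theory.
Import numFieldNormedType.Exports.
Local Open Scope classical_set_scope.
Local Open Scope ring_scope.

Section Iid.
Context d (Omega : measurableType d) (R : realType) (P : probability Omega R).
Implicit Type X : nat -> {RV P >-> R}.
Local Open Scope ereal_scope.

Definition mutually_independent X :=
  forall (J : {fset nat}) (B : nat -> set R),
    (forall i, measurable (B i)) ->
    P (\bigcap_(i in [set` J]) (X i @^-1` B i)) =
    \prod_(i <- J) P (X i @^-1` B i).

Definition identically_distributed X :=
  forall (i j : nat) (B : set R), measurable B ->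
    distribution P (X i) B = distribution P (X j) B.

Definition iid X := mutually_independent X /\ identically_distributed X.

End Iid.

Section LogMgf.
Context d (Omega : measurableType d) (R : realType) (P : probability Omega R).
Variable Y : {RV P >-> R}.

(* [lne] maps +oo to +oo, and the moment generating function is positive, so
   [log_mgf] takes its values in ]-oo, +oo]. *)
Definition log_mgf (alpha : R) : \bar R := lne ('M_P Y alpha).

Definition log_mgf_dom : set R := [set alpha | (log_mgf alpha < +oo)%E].

(* Only meaningful on [log_mgf_dom], which will be a neighbourhood of 0. *)
Definition log_mgf_real (alpha : R) : R := fine (log_mgf alpha).

Definition log_mgf'0 : R := derive1 log_mgf_real 0.
Definition log_mgf''0 : R := derive1n 2 log_mgf_real 0.

End LogMgf.

Section Renewal.
Context (Omega : Type) (R : realType).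
(* [X n] stands for T_{n+1}; thus [arrival n] is T_1 + ... + T_n. *)
Variable X : nat -> Omega -> R.

Definition arrival (n : nat) (w : Omega) : R := \sum_(i < n) X i w.

Local Open Scope ereal_scope.

(* Extended-valued: N(t) may be +oo where the arrival times accumulate. *)
Definition renewal (t : R) (w : Omega) : \bar R :=
  \sum_(1 <= n <oo) ((arrival n w <= t)%R%:R)%:E.

(* Every [arrival n w] is finite, so N(t) tends to +oo and this is the infimum
   of a nonempty set bounded below by 0. *)
Definition hitting (x : R) (w : Omega) : R :=
  inf [set t : R | (0 <= t)%R /\ x%:E - renewal t w <= 0].

(* When the [X i w] are positive, N is finite on [0, tau(x)], so the integral is
   finite and [fine] loses nothing. *)
Definition area (x : R) (w : Omega) : R :=
  fine (\int[lebesgue_measure]_(t in `[0%R, hitting x w])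
          (x%:E - renewal t w)).

End Renewal.

Section LargeDeviations.
Context (R : realType) (h : nat).
Implicit Type I : 'rV[R]_h -> \bar R.
Local Open Scope ereal_scope.

Definition rate_function I :=
  (forall z, 0 <= I z) /\ lower_semicontinuous I.

Definition good_rate_function I :=
  rate_function I /\
  forall eta : R, (0 <= eta)%R -> compact [set z | I z <= eta%:E].

Context d (Omega : measurableType d) (P : probability Omega R).

(* Measurability with respect to the Borel sigma-algebra of R^h. *)
Definition random_vector (Z : Omega -> 'rV[R]_h) :=
  forall B : set 'rV[R]_h, <<s @open 'rV[R]_h >> B -> measurable (Z @^-1` B).

(* Families are indexed by all reals, but only the members with x > 0 matter. *)
Definition LDP (Z : R -> Omega -> 'rV[R]_h) (v : R -> R) I :=
  [/\ forall x : R, (0 < x)%R -> random_vector (Z x),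
      v x @[x --> +oo%R] --> +oo%R,
      rate_function I,
      forall C : set 'rV[R]_h, closed C ->
        limf_esup (fun x : R => ((v x)^-1)%:E * lne (P (Z x @^-1` C))) +oo%R
          <= - ereal_inf (I @` C) &
      forall O : set 'rV[R]_h, open O ->
        - ereal_inf (I @` O)
          <= limf_einf (fun x : R => ((v x)^-1)%:E * lne (P (Z x @^-1` O)))
               +oo%R].

End LargeDeviations.

Section Proposition.
Context (R : realType).

Definition vec2 (u v : R) : 'rV[R]_2 := \row_(j < 2) [:: u; v]`_j.

Definition mat2 (a b c e : R) : 'M[R]_2 :=
  \matrix_(i < 2, j < 2) (nth [::] [:: [:: a; b]; [:: c; e]] i)`_j.

(* In [covC], [hatC] and [psi_star], [s] is the variance phi''(0). *)
Definition covC (s : R) : 'M[R]_2 := s *: mat2 1 (1 / 2) (1 / 2) (1 / 3).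

Definition hatC (s : R) : 'M[R]_2 := s^-1 *: mat2 4 (- 6) (- 6) 12.

Definition psi_star (s : R) (z : 'rV[R]_2) : \bar R :=
  (1 / 2 * \sum_(i < 2) \sum_(j < 2) hatC s i j * z 0 i * z 0 j)%:E.

(* The centred and rescaled pair; [m] is the mean phi'(0). *)
Definition scaled_pair (Omega : Type) (X : nat -> Omega -> R) (m : R)
    (a : R -> R) (x : R) (w : Omega) : 'rV[R]_2 :=
  Num.sqrt (x * a x) *:
    vec2 (hitting X x w / x - m) (area X x w / x ^+ 2 - 1 / 2 * m).

End Proposition.

(* Main.v *)
Require Import Defs.
From HB Require Import structures.
From mathcomp Require Import all_boot all_order all_algebra finmap.
From mathcomp Require Import all_classical all_reals all_analysis.
From mathcomp Require Import measurable_realfun ring lra zify.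
Set Implicit Arguments.
Unset Strict Implicit.
Unset Printing Implicit Defensive.
Import Order.TTheory GRing.Theory Num.Theory.
Import numFieldNormedType.Exports.
Local Open Scope classical_set_scope.
Local Open Scope ring_scope.

(**
Let [S_n] be the [n]-th arrival time and [n] the ceiling of [x].  The arrival
times increase strictly, so [N(t) >= x] exactly when [S_n <= t]; hence
[tau(x) = S_n], and integrating the counting function up to [S_n] gives
[A(x) = \sum_(i < n) (x - i) T_(i+1)] ([hittingE], [areaE]).  So every linear
functional [t1 Z1 + t2 Z2] of the rescaled pair, divided by [a_x], is a constant
plus [\sum_(i < n) b_i T_(i+1)] with
[b_i = (x a_x)^(-1/2) (t1 + t2 (1 - i / x))] ([scaled_pair_linear]).

By independence the moment generating function of such a sum is a product
([mmt_gen_fun_wsum]).  Since [x a_x] tends to infinity the [b_i] are uniformly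
small, and the expansion [phi(b) = phi'(0) b + phi''(0) b^2 / 2 + o(b^2)]
([log_mgf_expansion]) turns [a_x] times its logarithm into a Riemann sum for
[phi''(0) / 2 * \int_0^1 (t1 + t2 u)^2 du], which is half the quadratic form of
[C] ([cumulant_approx], [scaled_pair_mgf]).

It remains to pass from this limit of cumulant functions to the large deviation
principle.  In the coordinates [y1 = z1 / sqrt s] and
[y2 = sqrt 3 (z1 - 2 z2) / sqrt s], with [s = phi''(0)], the limit becomes
[(u1^2 + u2^2) / 2] and the rate function [(y1^2 + y2^2) / 2].  This quadratic
case of the theorem of Gaertner and Ellis has a direct proof.
- Upper bound ([upper_tail]): a closed set is contained in a set
  [{y1^2 + y2^2 >= 2 J}], where [J] is the infimum of the rate on it.  The outside
  of a disc is covered, up to an arbitrarily small loss in [J], by finitely many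
  half-planes, and each half-plane is handled by an exponential Markov inequality.
- Lower bound ([lower_box]): the integral of [exp((y . Y) / a)] is asymptotically
  concentrated on a small box around [y], because the part outside the box is
  bounded by four exponential moments with strictly smaller rate.  On the box the
  integrand is essentially constant, which bounds the probability of the box from
  below.
*)

(** * Borel measurability in the plane *)

Lemma measurable_lt_set d (T : measurableType d) (R : realType) (f g : T -> R) :
  measurable_fun setT f -> measurable_fun setT g ->
  measurable [set w | f w < g w].
Proof.
move=> mf mg; rewrite -[X in measurable X]setTI.
exact: (measurable_fun_ltr mf mg measurableT (Y := [set true])).
Qed.

Lemma ord2P (j : 'I_2) : j = 0 \/ j = 1.
Proof. by case: j => -[|[|//]] jlt; [left|right]; exact/val_inj. Qed.

Section PlaneTopology.
Context (R : realType).

Lemma mx_ball2 (z z' : 'rV[R]_2) (e : R) : 0 < e ->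
  `|z' 0 0 - z 0 0| < e -> `|z' 0 1 - z 0 1| < e -> ball z e z'.
Proof.
move=> e0 h0 h1; split => // i j; rewrite (ord1 i) /ball/=.
have [->|->] := ord2P j.
  by rewrite distrC.
by rewrite distrC.
Qed.

(** The open sets of the plane are countable unions of boxes with rational centres
and inverse integer radii, so measurable coordinates suffice. *)
Lemma random_vector2 d (Omega : measurableType d) (Z : Omega -> 'rV[R]_2) :
  measurable_fun setT (fun w => Z w 0 0) ->
  measurable_fun setT (fun w => Z w 0 1) -> random_vector Z.
Proof.
move=> mZ0 mZ1.
apply: (@smallest_sub _ (sigma_algebra setT) _ [set B | measurable (Z @^-1` B)]).
  split => /=.
  - by rewrite preimage_set0.
  - move=> A mA; rewrite setTD preimage_setC; exact: measurableC.
  - by move=> A mA; rewrite preimage_bigcup; exact: bigcup_measurable.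
move=> O oO /=.
pose box (p : rat * rat * nat) := [set z : 'rV[R]_2 |
  `|z 0 0 - ratr p.1.1| < p.2.+1%:R^-1 /\ `|z 0 1 - ratr p.1.2| < p.2.+1%:R^-1].
pose F p := if `[< box p `<=` O >] then Z @^-1` box p else set0.
have -> : Z @^-1` O = \bigcup_p F p.
  apply/seteqP; split => w /=; last first.
    move=> [p _]; rewrite /F; case: asboolP => // sub; exact: sub.
  move=> Ow; have /nbhs_ballP[e /= e0 eO] : nbhs (Z w) O by exact: open_nbhs_nbhs.
  have [k] : exists k : nat, k.+1%:R^-1 < e / 2.
    have e2 : 0 < (e / 2)^-1 by rewrite invr_gt0 divr_gt0.
    have /andP[_ t2] := Num.Theory.truncn_itv (ltW e2).
    exists (Num.truncn (e / 2)^-1); rewrite -[ltRHS]invrK ltf_pV2// posrE ?ltr0n//.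
  set r := k.+1%:R^-1 => rk.
  have r0 : 0 < r by rewrite invr_gt0 ltr0n.
  have approx (y : R) : exists q : rat, `|y - ratr q| < r.
    have [q] := @rat_in_itvoo R (y - r) (y + r) ltac:(lra).
    by rewrite in_itv/= => /andP[q1 q2]; exists q; rewrite ltr_norml; lra.
  have [q0 hq0] := approx (Z w 0 0); have [q1 hq1] := approx (Z w 0 1).
  exists (q0, q1, k) => //; rewrite /F; case: asboolP => // nsub; exfalso; apply: nsub.
  move=> z [/= z0 z1]; apply: eO; apply: mx_ball2 => //.
    move: hq0 z0; rewrite -/r !ltr_norml => /andP[h1 h2] /andP[h3 h4]; lra.
  move: hq1 z1; rewrite -/r !ltr_norml => /andP[h1 h2] /andP[h3 h4]; lra.
apply: countable_bigcupT_measurable; first exact: countableP.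
move=> p; rewrite /F; case: asboolP => // _.
by apply: measurableI; apply: measurable_lt_set => //; apply: measurableT_comp => //;
  exact: measurable_funB.
Qed.
End PlaneTopology.


(** * Two-sided Gaussian estimates from the scaled cumulant function *)

Section GaussianLimit.
Context (R : realType) d (T : measurableType d) (P : probability T R).
Context (Y1 Y2 : R -> T -> R) (a : R -> R).
Hypothesis mY1 : forall x, 0 < x -> measurable_fun setT (Y1 x).
Hypothesis mY2 : forall x, 0 < x -> measurable_fun setT (Y2 x).
Hypothesis a_gt0 : forall x : R, 0 < x -> 0 < a x.
Hypothesis a_to0 : a x @[x --> +oo] --> (0 : R).

(** The exponential weight of the linear functional [(u1, u2)], normalised by the
level [c]. *)
Definition tilt u1 u2 c x w : R := expR ((u1 * Y1 x w + u2 * Y2 x w - c) / a x).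

Hypothesis mgfY : forall u1 u2 eps : R, 0 < eps -> \forall x \near +oo,
  ((expR (((u1 ^+ 2 + u2 ^+ 2) / 2 - eps) / a x))%:E
    <= \int[P]_w (tilt u1 u2 0 x w)%:E
    <= (expR (((u1 ^+ 2 + u2 ^+ 2) / 2 + eps) / a x))%:E)%E.

Let gt0_near : \forall x \near +oo, 0 < (x : R).
Proof. exact: nbhs_pinfty_gt. Qed.

(** Constant factors are negligible on the exponential scale [1 / a x]. *)
Lemma near_cst_le_expR (K c : R) : 0 < c -> \forall x \near +oo, K <= expR (c / a x).
Proof.
move=> c0; pose K' := Num.max K 1.
have K'0 : 0 < K' by rewrite lt_max ltr01 orbT.
have cK : 0 < c / K' by rewrite divr_gt0.
near=> x; have x0 : 0 < x by near: x.
have ax := a_gt0 x0.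
have : a x < c / K' by near: x; exact: (cvgr_lt _ a_to0).
rewrite ltr_pdivlMr// => h.
apply: (@le_trans _ _ K'); first by rewrite le_max lexx.
apply: (@le_trans _ _ (c / a x)); first by rewrite ler_pdivlMr// mulrC ltW.
by rewrite (le_trans _ (expR_ge1Dx _))// lerDr.
Unshelve. all: end_near. Qed.

Lemma measurable_tilt u1 u2 c x : 0 < x -> measurable_fun setT (tilt u1 u2 c x).
Proof.
move=> x0; apply: measurableT_comp => //; apply: measurable_funM => //.
apply: measurable_funB => //; apply: measurable_funD; apply: measurable_funM => //.
  exact: mY1.
exact: mY2.
Qed.

Lemma tiltE u1 u2 c x w : tilt u1 u2 c x w = expR (- (c / a x)) * tilt u1 u2 0 x w.
Proof. by rewrite /tilt -expRD; congr expR; ring. Qed.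

(** The union bound on the exponential scale: the number of terms is absorbed by
[eps], and each term contributes the value at [(u1, u2)] of the limiting cumulant
function minus the level. *)
Lemma sum_tilt_le (I : finType) (u1 u2 c : I -> R) (L : R) :
  (forall i, (u1 i ^+ 2 + u2 i ^+ 2) / 2 - c i <= L) ->
  forall eps, 0 < eps -> \forall x \near +oo,
  (\int[P]_w (\sum_i tilt (u1 i) (u2 i) (c i) x w)%:E
    <= (expR ((L + eps) / a x))%:E)%E.
Proof.
move=> uL eps eps0; have e20 : 0 < eps / 2 by rewrite divr_gt0.
near=> x; have x0 : 0 < x by near: x.
have ax := a_gt0 x0.
have mt i : measurable_fun setT (fun w => (tilt (u1 i) (u2 i) (c i) x w)%:E).
  by apply/measurable_EFinP; exact: measurable_tilt.
under eq_integral => w _ do rewrite -sumEFin.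
rewrite ge0_integral_sum//; last by move=> i w _; rewrite lee_fin expR_ge0.
have tiltL i : (\int[P]_w (tilt (u1 i) (u2 i) (c i) x w)%:E
    <= (expR ((L + eps / 2) / a x))%:E)%E.
  under eq_integral => w _ do rewrite tiltE EFinM.
  rewrite ge0_integralZl//; last 2 first.
  - by apply/measurable_EFinP; exact: measurable_tilt.
  - by move=> w _; rewrite lee_fin expR_ge0.
  have /andP[_ le2] : ((expR (((u1 i ^+ 2 + u2 i ^+ 2) / 2 - eps / 2) / a x))%:E
    <= \int[P]_w (tilt (u1 i) (u2 i) 0 x w)%:E
    <= (expR (((u1 i ^+ 2 + u2 i ^+ 2) / 2 + eps / 2) / a x))%:E)%E.
    by move: i; near: x; apply: filter_forall => i; exact: mgfY.
  apply: (le_trans (lee_wpmul2l _ le2)); first by rewrite lee_fin expR_ge0.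
  rewrite -EFinM lee_fin -expRD ler_expR -mulNr -mulrDl ler_pM2r ?invr_gt0//.
  by have := uL i; lra.
apply: (@le_trans _ _ (\sum_(i : I) (expR ((L + eps / 2) / a x))%:E)%E).
  by apply: lee_sum.
rewrite sumEFin lee_fin sumr_const.
have -> : (L + eps) / a x = eps / 2 / a x + (L + eps / 2) / a x by field; rewrite gt_eqF.
rewrite expRD -[leLHS]mulr_natl ler_pM2r ?expR_gt0//.
by near: x; exact: near_cst_le_expR.
Unshelve. all: end_near. Qed.

Lemma measurable_sum_tilt (I : finType) (u1 u2 c : I -> R) x : 0 < x ->
  measurable_fun setT (fun w => \sum_i tilt (u1 i) (u2 i) (c i) x w).
Proof. by move=> x0; apply: measurable_sum => i; exact: measurable_tilt. Qed.

Lemma sum_tilt_ge1 (I : finType) (u1 u2 c : I -> R) x w i : 0 < x ->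
  c i <= u1 i * Y1 x w + u2 i * Y2 x w ->
  1 <= \sum_i tilt (u1 i) (u2 i) (c i) x w.
Proof.
move=> x0 ci; rewrite (bigD1 i)//= -[leLHS]addr0 lerD//; last first.
  by apply: sumr_ge0 => j _; exact: expR_ge0.
rewrite -expR0 ler_expR divr_ge0 ?subr_ge0//.
exact/ltW/a_gt0.
Qed.

Lemma prob_le_integral (A : set T) (f : T -> R) : measurable A ->
  measurable_fun setT f -> (forall w, 0 <= f w) -> (forall w, A w -> 1 <= f w) ->
  (P A <= \int[P]_w (f w)%:E)%E.
Proof.
move=> mA mf f0 f1.
have -> : P A = (\int[P]_w (\1_A w)%:E)%E by rewrite integral_indic ?setIT.
apply: ge0_le_integral => //.
- exact/measurable_EFinP.
- exact/measurable_EFinP.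
- move=> w _; rewrite lee_fin indicE; have [/set_mem Aw|_] := boolP (w \in A) => //=.
  exact: f1.
Qed.

(** The vectors [g] of a grid of mesh [1 / K] come within distance
[sqrt 2 / K] of every unit vector [p], and [2 (g . p) = 1 + |g|^2 - |g - p|^2].
So the half-planes below, whose levels do not depend on the point, cover the
outside of the disc of radius [r]. *)
Lemma circle_cover (K : nat) (r y1 y2 : R) : (2 <= K)%N -> 0 < r ->
  r ^+ 2 <= y1 ^+ 2 + y2 ^+ 2 ->
  exists i j : 'I_(2 * K + 1)%N,
    let g (i : 'I_(2 * K + 1)%N) : R := i%:R / K%:R - 1 in
    r ^+ 2 * (1 + g i ^+ 2 + g j ^+ 2 - 2 / K%:R ^+ 2) / 2
     <= r * g i * y1 + r * g j * y2.
Proof.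
move=> K2 r0 ry.
have K0 : 0 < K%:R :> R by rewrite ltr0n; lia.
have grid (p : R) : -1 <= p <= 1 ->
    exists i : 'I_(2 * K + 1)%N, (p - (i%:R / K%:R - 1)) ^+ 2 <= (K%:R ^+ 2)^-1.
  move=> /andP[p1 p2].
  have q0 : 0 <= K%:R * (p + 1) by rewrite mulr_ge0 ?ler0n//; lra.
  have /andP[t1 t2] := Num.Theory.truncn_itv q0.
  set t := Num.truncn _ in t1 t2.
  have tlt : (t < 2 * K + 1)%N.
    rewrite -(ltr_nat R) natrD natrM (le_lt_trans t1)//.
    have : K%:R * (p + 1) <= K%:R * 2 by rewrite ler_pM2l//; lra.
    by lra.
  exists (Ordinal tlt) => /=.
  have -> : p - (t%:R / K%:R - 1) = (K%:R * (p + 1) - t%:R) / K%:R.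
    by field; rewrite gt_eqF.
  rewrite expr_div_n ler_pdivrMr ?exprn_gt0// mulVf ?gt_eqF ?exprn_gt0//.
  rewrite expr_le1//; last by lra.
  by move: t2; rewrite -natr1; lra.
set t := Num.sqrt (y1 ^+ 2 + y2 ^+ 2).
have t2 : t ^+ 2 = y1 ^+ 2 + y2 ^+ 2 by rewrite sqr_sqrtr// addr_ge0 ?sqr_ge0.
have rt : r <= t by rewrite -(@ler_pXn2r _ 2)// ?nnegrE ?t2 ?sqrtr_ge0// ltW.
have t0 : 0 < t by exact: lt_le_trans rt.
have unit_le (y z : R) : t ^+ 2 = y ^+ 2 + z ^+ 2 -> -1 <= y / t <= 1.
  move=> tE; rewrite -ler_norml normrM [X in _ * X]gtr0_norm ?invr_gt0//.
  rewrite ler_pdivrMr// mul1r -(@ler_pXn2r _ 2)// ?nnegrE// ?(ltW t0)//.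
  by rewrite real_normK ?num_real// tE lerDl sqr_ge0.
have [i iP] := grid _ (unit_le _ _ t2).
have [j jP] := grid _ (unit_le y2 y1 ltac:(by rewrite t2 addrC)).
exists i, j => g.
move: iP jP; rewrite -/(g i) -/(g j); set gi := g i; set gj := g j.
have [] : y1 = t * (y1 / t) /\ y2 = t * (y2 / t) by split; field; rewrite gt_eqF.
have : (y1 / t) ^+ 2 + (y2 / t) ^+ 2 = 1.
  by rewrite !expr_div_n -mulrDl -t2 mulfV// expf_neq0// gt_eqF.
set p1 := y1 / t; set p2 := y2 / t => p12 -> -> iP jP.
have k4 : (K%:R ^+ 2)^-1 <= 1 / 4 :> R.
  rewrite -[leLHS]div1r ler_pdivrMr ?exprn_gt0//.
  have : 2 <= K%:R :> R by rewrite (ler_nat R 2 K).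
  by nra.
set k := (K%:R ^+ 2)^-1 in iP jP k4 *.
have q : (1 + gi ^+ 2 + gj ^+ 2 - 2 * k) / 2 <= gi * p1 + gj * p2 by nra.
have q0 : 0 <= (1 + gi ^+ 2 + gj ^+ 2 - 2 * k) / 2 by nra.
have -> : r * gi * (t * p1) + r * gj * (t * p2) = r * (t * (gi * p1 + gj * p2)) by ring.
have -> : r ^+ 2 * (1 + gi ^+ 2 + gj ^+ 2 - 2 * k) / 2 =
    r * (r * ((1 + gi ^+ 2 + gj ^+ 2 - 2 * k) / 2)) by ring.
rewrite ler_pM2l// ler_pM// ltW//.
Qed.

Lemma measurable_tail (J x : R) : 0 < x ->
  measurable [set w | 2 * J <= Y1 x w ^+ 2 + Y2 x w ^+ 2].
Proof.
move=> x0; rewrite -[X in measurable X]setTI.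
apply: (measurable_fun_le measurableT) => //.
by apply: measurable_funD; apply: measurable_funX; [exact: mY1|exact: mY2].
Qed.

Lemma measurable_box (y1 y2 e x : R) : 0 < x ->
  measurable [set w | `|Y1 x w - y1| < e /\ `|Y2 x w - y2| < e].
Proof.
move=> x0; apply: measurableI; apply: measurable_lt_set => //; apply: measurableT_comp => //;
  apply: measurable_funB => //; [exact: mY1|exact: mY2].
Qed.

(** For the half-plane with normal [r g] of [circle_cover] the exponential Markov
inequality gives the exponent [|r g|^2 / 2 - r^2 (1 + |g|^2 - 2 / K^2) / 2], which
is [- J + 2 J / K^2] whatever [g] is. *)
Lemma upper_tail (J eps : R) : 0 <= J -> 0 < eps -> \forall x \near +oo,
  (P [set w | (2 * J <= Y1 x w ^+ 2 + Y2 x w ^+ 2)%R] <= (expR ((- J + eps) / a x))%:E)%E.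
Proof.
rewrite le_eqVlt => /predU1P[<- eps0|J0 eps0].
  near=> x; have x0 : 0 < x by near: x.
  rewrite oppr0 add0r; apply: (@le_trans _ _ 1%E).
    apply: probability_le1; exact: measurable_tail.
  rewrite lee_fin -expR0 ler_expR divr_ge0// ltW//.
  exact: a_gt0.
have e20 : 0 < eps / 2 by rewrite divr_gt0.
pose r := Num.sqrt (2 * J).
have r2 : r ^+ 2 = 2 * J by rewrite sqr_sqrtr// mulr_ge0// ltW.
have r0 : 0 < r by rewrite sqrtr_gt0 mulr_gt0.
(* This [K] makes the covering loss [2 J / K^2] at most [eps / 2]. *)
pose K := (Num.truncn (4 * J / eps)).+2.
have K2 : (2 <= K)%N by [].
have K0 : 0 < K%:R :> R by rewrite ltr0n; lia.
have KJ : 2 * J / K%:R ^+ 2 <= eps / 2.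
  have q0 : 0 <= 4 * J / eps by rewrite divr_ge0 ?mulr_ge0// ltW.
  have /andP[_ t2] := Num.Theory.truncn_itv q0.
  have : 4 * J / eps < K%:R by rewrite (lt_le_trans t2)// ler_nat.
  rewrite ltr_pdivrMr// => JK.
  have K1 : 1 <= K%:R :> R by rewrite (ler_nat R 1 K).
  rewrite ler_pdivrMr ?exprn_gt0//.
  have : K%:R * eps <= K%:R * (K%:R * eps) by rewrite ler_peMl// mulr_ge0// ltW.
  by lra.
pose N := (2 * K + 1)%N.
pose g (i : 'I_N) : R := i%:R / K%:R - 1.
pose c (p : 'I_N * 'I_N) := r ^+ 2 * (1 + g p.1 ^+ 2 + g p.2 ^+ 2 - 2 / K%:R ^+ 2) / 2.
have lev (p : 'I_N * 'I_N) : ((r * g p.1) ^+ 2 + (r * g p.2) ^+ 2) / 2 - c p <= - J + eps / 2.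
  rewrite /c !exprMn r2.
  have -> : (2 * J * g p.1 ^+ 2 + 2 * J * g p.2 ^+ 2) / 2 -
      2 * J * (1 + g p.1 ^+ 2 + g p.2 ^+ 2 - 2 / K%:R ^+ 2) / 2 =
      - J + 2 * J / K%:R ^+ 2 by field; rewrite gt_eqF.
  by rewrite lerD2l.
near=> x; have x0 : 0 < x by near: x.
have -> : - J + eps = - J + eps / 2 + eps / 2 by field.
apply: (@le_trans _ _ (\int[P]_w (\sum_(p : 'I_N * 'I_N)
   tilt (r * g p.1) (r * g p.2) (c p) x w)%:E)%E); last first.
  by near: x; exact: sum_tilt_le.
apply: prob_le_integral.
- exact: measurable_tail.
- exact: measurable_sum_tilt.
- by move=> w; apply: sumr_ge0 => p _; exact: expR_ge0.
- move=> w /=; rewrite -r2 => /(circle_cover K2 r0)[i [j ij]].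
  exact: (@sum_tilt_ge1 _ (fun p => r * g p.1) (fun p => r * g p.2) c x w (i, j)).
Unshelve. all: end_near. Qed.

(** Outside the box of radius [e] around [y] one of the four functionals
[+- (Y_i - y_i)] is at least [e], so there the weight of [y] is dominated by the
weight of [y] shifted by [e] in that direction.  The shifted weights have
exponent at most [|y|^2 / 2 - e^2 / 2], hence are negligible against the total
mass, of exponent [|y|^2 / 2]. *)
Lemma lower_box (y1 y2 e0 eta : R) : 0 < e0 -> 0 < eta -> \forall x \near +oo,
  ((expR (- ((y1 ^+ 2 + y2 ^+ 2) / 2 + eta) / a x))%:E <=
   P [set w | (`|Y1 x w - y1| < e0)%R /\ (`|Y2 x w - y2| < e0)%R])%E.
Proof.
move=> e00 eta0.
pose M := 1 + `|y1| + `|y2|.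
have M1 : 1 <= M by rewrite /M; have := normr_ge0 y1; have := normr_ge0 y2; lra.
have M0 : 0 < M by exact: lt_le_trans M1.
pose e := Num.min e0 (Num.min 1 (eta / M)).
have e_gt0 : 0 < e by rewrite !lt_min e00 ltr01 divr_gt0.
have e_le1 : e <= 1 by rewrite !ge_min lexx orbT.
have e_lee0 : e <= e0 by rewrite ge_min lexx.
have eM : e * M <= eta by rewrite -ler_pdivlMr// !ge_min lexx !orbT.
pose S := (y1 ^+ 2 + y2 ^+ 2) / 2.
(* A margin [dl] with [e ^+ 2 / 2 = 3 * dl], so that the exponents [S - dl] of the
   total mass and [S - e ^+ 2 / 2 + dl] of the outer part differ by [dl]. *)
pose dl := e ^+ 2 / 6.
have dl0 : 0 < dl by rewrite divr_gt0 ?exprn_gt0.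
pose sg (b : bool) : R := (-1) ^+ b.
(* The four unit directions: [p.1] selects the axis and [p.2] the sign. *)
pose d1 (p : bool * bool) : R := if p.1 then sg p.2 else 0.
pose d2 (p : bool * bool) : R := if p.1 then 0 else sg p.2.
pose u1 p := y1 + e * d1 p.
pose u2 p := y2 + e * d2 p.
pose c p := e * (d1 p * y1 + d2 p * y2 + e).
have lev p : (u1 p ^+ 2 + u2 p ^+ 2) / 2 - c p <= S - e ^+ 2 / 2.
  have dd : d1 p ^+ 2 + d2 p ^+ 2 = 1.
    by rewrite /d1 /d2 /sg; case: p.1; rewrite ?expr0n/= ?addr0 ?add0r sqrr_sign.
  rewrite /u1 /u2 /c /S.
  have -> : ((y1 + e * d1 p) ^+ 2 + (y2 + e * d2 p) ^+ 2) / 2 -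
      e * (d1 p * y1 + d2 p * y2 + e) =
      (y1 ^+ 2 + y2 ^+ 2) / 2 + e ^+ 2 * (d1 p ^+ 2 + d2 p ^+ 2) / 2 - e ^+ 2 by field.
  by rewrite dd; lra.
near=> x; have x0 : 0 < x by near: x.
have ax := a_gt0 x0.
pose B := [set w | `|Y1 x w - y1| < e /\ `|Y2 x w - y2| < e].
have mB : measurable B by exact: measurable_box.
apply: (@le_trans _ _ (P B)); last first.
  apply: le_measure; rewrite ?inE//; first exact: measurable_box.
  by move=> w /= [w1 w2]; split; [exact: lt_le_trans w1 _|exact: lt_le_trans w2 _].
pose k := 2 * S + e * (`|y1| + `|y2|).
have pointwise w : tilt y1 y2 0 x w <=
    expR (k / a x) * \1_B w + \sum_p tilt (u1 p) (u2 p) (c p) x w.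
  have sum0 : 0 <= \sum_p tilt (u1 p) (u2 p) (c p) x w.
    by apply: sumr_ge0 => p _; exact: expR_ge0.
  have [Bw|nBw] := pselect (B w).
    rewrite indicE mem_set// mulr1 -[leLHS]addr0 lerD// ler_expR subr0.
    rewrite ler_pM2r ?invr_gt0//.
    have [b1 b2] := Bw.
    have h (y z : R) : `|z - y| < e -> y * z <= y ^+ 2 + e * `|y|.
      move=> zy; have -> : y * z = y ^+ 2 + y * (z - y) by ring.
      rewrite lerD2l (le_trans (ler_norm _))// normrM mulrC ler_wpM2r//.
      exact: ltW.
    by have := h _ _ b1; have := h _ _ b2; rewrite /k /S; lra.
  rewrite indicE memNset// mulr0 add0r.
  suff [p pP] : exists p, e <= d1 p * (Y1 x w - y1) + d2 p * (Y2 x w - y2).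
    rewrite (bigD1 p)//= -[leLHS]addr0 lerD//; last first.
      by apply: sumr_ge0 => q _; exact: expR_ge0.
    rewrite ler_expR ler_pM2r ?invr_gt0// subr0.
    rewrite /u1 /u2 /c -subr_ge0.
    have -> : (y1 + e * d1 p) * Y1 x w + (y2 + e * d2 p) * Y2 x w -
      e * (d1 p * y1 + d2 p * y2 + e) - (y1 * Y1 x w + y2 * Y2 x w) =
      e * (d1 p * (Y1 x w - y1) + d2 p * (Y2 x w - y2) - e) by ring.
    by rewrite mulr_ge0 ?subr_ge0// ltW.
  have side z : e <= `|z| -> exists b, e <= sg b * z.
    move=> ez; have [z0|z0] := leP 0 z.
      by exists false; rewrite /sg expr0 mul1r -(ger0_norm z0).
    by exists true; rewrite /sg expr1 mulN1r -(ltr0_norm z0).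
  have [e1|e1] := leP e `|Y1 x w - y1|.
    have [b bP] := side _ e1; exists (true, b).
    by rewrite /d1 /d2/= mul0r addr0.
  have [e2|e2] := leP e `|Y2 x w - y2|; last by exfalso; apply: nBw.
  have [b bP] := side _ e2; exists (false, b).
  by rewrite /d1 /d2/= mul0r add0r.
have int_le : (\int[P]_w (tilt y1 y2 0 x w)%:E <=
    (expR (k / a x))%:E * P B + (expR ((S - e ^+ 2 / 2 + dl) / a x))%:E)%E.
  have mI : measurable_fun setT (fun w => expR (k / a x) * \1_B w).
    by apply: measurable_funM.
  have mS : measurable_fun setT (fun w => \sum_p tilt (u1 p) (u2 p) (c p) x w).
    exact: measurable_sum_tilt.
  apply: (@le_trans _ _ (\int[P]_w
      ((expR (k / a x) * \1_B w)%:E + (\sum_p tilt (u1 p) (u2 p) (c p) x w)%:E))%E).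
    apply: ge0_le_integral => //.
    - by move=> w _; rewrite lee_fin expR_ge0.
    - by apply/measurable_EFinP; exact: measurable_tilt.
    - by apply: emeasurable_funD; exact/measurable_EFinP.
    - by move=> w _; rewrite -EFinD lee_fin.
  rewrite ge0_integralD//; last 3 first.
  - exact/measurable_EFinP.
  - by move=> w _; rewrite lee_fin; apply: sumr_ge0 => p _; exact: expR_ge0.
  - exact/measurable_EFinP.
  apply: leeD.
    under eq_integral => w _ do rewrite EFinM.
    rewrite ge0_integralZl//; last by apply/measurable_EFinP.
    by rewrite integral_indic// setIT.
  by near: x; exact: sum_tilt_le.
have /andP[int_ge _] : ((expR ((S - dl) / a x))%:E
    <= \int[P]_w (tilt y1 y2 0 x w)%:E
    <= (expR ((S + dl) / a x))%:E)%E by near: x; exact: mgfY.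
have := le_trans int_ge int_le.
have PBfin : P B \is a fin_num by exact: fin_num_measure.
rewrite -(fineK PBfin) -EFinM -EFinD !lee_fin; set p := fine (P B) => le_p.
have dlE : 6 * dl = e ^+ 2 by rewrite /dl; field.
have two : 2 <= expR (dl / a x) by near: x; exact: near_cst_le_expR.
have E1 : (S - dl) / a x = dl / a x + (S - 2 * dl) / a x by ring.
have E3 : (S - e ^+ 2 / 2 + dl) / a x = (S - 2 * dl) / a x.
  by rewrite -dlE; congr (_ / _); field.
move: le_p; rewrite E3 E1 expRD; set z := expR ((S - 2 * dl) / a x) => le_p.
have z0 : 0 < z by exact: expR_gt0.
have zle : z <= expR (k / a x) * p by nra.
have zE : z = expR (k / a x) * expR ((S - 2 * dl - k) / a x).
  by rewrite -expRD; congr expR; ring.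
move: zle; rewrite zE ler_pM2l ?expR_gt0//; apply: le_trans.
rewrite ler_expR ler_pM2r ?invr_gt0// /k.
have : e * e <= e by rewrite ler_piMr// ltW.
by move: eM; rewrite /M -/S; move: dlE; rewrite expr2; nra.
Unshelve. all: end_near. Qed.

End GaussianLimit.

(** * Second-order expansion of the logarithmic moment generating function *)

Section Mgf.
Context (R : realType).

Lemma expr_le_expR (k : nat) (r : R) : 0 < r ->
  exists2 C : R, 0 < C & forall y, 0 <= y -> y ^+ k <= C * expR (r * y).
Proof.
elim: k r => [|k IH] r r0.
  exists 1 => // y y0; rewrite expr0 mul1r.
  by rewrite (le_trans _ (expR_ge1Dx _))// lerDl mulr_ge0// ltW.
have r20 : 0 < r / 2 by rewrite divr_gt0.
have [C C0 CP] := IH _ r20.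
exists ((r / 2)^-1 * C) => [|y y0]; first by rewrite mulr_gt0// invr_gt0.
have -> : r * y = r / 2 * y + r / 2 * y by field.
rewrite exprS expRD mulrACA ler_pM//.
- by rewrite exprn_ge0.
- rewrite ler_pdivlMl// (le_trans _ (expR_ge1Dx _))//.
  by rewrite lerDr.
- exact: CP.
Qed.

Context d (T : measurableType d) (P : probability T R) (Y : T -> R).
Hypothesis mY : measurable_fun setT Y.
Hypothesis Y0 : forall w, 0 < Y w.

(** The [k]-th derivative of the moment generating function of [Y] at [b]. *)
Definition exp_moment (k : nat) (b : R) : R :=
  \int[P]_w (Y w ^+ k * expR (b * Y w)).

Lemma measurable_exp_moment k b :
  measurable_fun setT (fun w => Y w ^+ k * expR (b * Y w)).
Proof.
apply: measurable_funM; first exact: measurable_funX.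
by apply: measurableT_comp => //; exact: measurable_funM.
Qed.

(** Differentiation under the integral sign: on a neighbourhood of [b] bounded away
from [r], the factor [Y ^+ k.+1] is absorbed by the gap in the exponent. *)
Lemma exp_moment_derive (r : R) k b : 0 < r ->
  P.-integrable setT (fun w => (expR (r * Y w))%:E) -> - r < b < r ->
  is_derive b 1 (exp_moment k) (exp_moment k.+1 b).
Proof.
move=> r0 intr.
suff main (rho : R) : 0 < rho -> rho < r -> - rho < b < rho ->
    is_derive b 1 (exp_moment k) (exp_moment k.+1 b).
  move=> /andP[rb br].
  have nbr : `|b| < r by rewrite ltr_norml rb.
  have h1 : `|b| < (r + `|b|) / 2 by lra.
  apply: (main ((r + `|b|) / 2)).
  - by have := normr_ge0 b; lra.
  - by lra.
  - by rewrite -ltr_norml.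
move=> rho0 rhor brho.
have dom j : exists2 C : R, 0 < C & forall x w, - rho < x < rho ->
    Y w ^+ j * expR (x * Y w) <= C * expR (r * Y w).
  have rr : 0 < r - rho by rewrite subr_gt0.
  have [C C0 CP] := expr_le_expR j rr.
  exists C => // x w /andP[_ xr].
  have -> : r * Y w = (r - rho) * Y w + rho * Y w by ring.
  rewrite expRD mulrA ler_pM//.
  - by rewrite exprn_ge0// ltW.
  - by apply: CP; exact: ltW.
  - by rewrite ler_expR ler_pM2r// ltW.
have inte j (x : R) : - rho < x < rho ->
    P.-integrable setT (EFin \o (fun w => Y w ^+ j * expR (x * Y w))).
  move=> xrho; have [C C0 CP] := dom j.
  apply: (le_integrable measurableT _ _ (integrableZl measurableT C intr)).
    by apply/measurable_EFinP; exact: measurable_exp_moment.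
  move=> w _ /=; rewrite lee_fin ger0_norm; last first.
    by rewrite mulr_ge0 ?expR_ge0 ?exprn_ge0// ltW.
  by rewrite ger0_norm ?CP// mulr_ge0 ?expR_ge0// ltW.
pose f (x : R) w := Y w ^+ k * expR (x * Y w).
have df (x : R) w : is_derive x 1 (f ^~ w) (Y w ^+ k.+1 * expR (x * Y w)).
  have dm : is_derive x 1 (fun z : R => z * Y w) (Y w).
    apply: is_derive_eq.
    by rewrite scaler0 add0r /GRing.scale/= mulr1.
  have de := @is_derive1_comp _ expR ( *%R^~ (Y w)) x _ _ (is_derive_expR _) dm.
  have := is_deriveZ (Y w ^+ k) de.
  by rewrite /GRing.scale/= [_ * Y w]mulrC mulrA -exprSr.
have d1f x w : partial1of2 f x w = Y w ^+ k.+1 * expR (x * Y w).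
  by rewrite partial1of2E; exact: (@derive_val _ _ _ _ _ _ _ (df x w)).
have [C C0 CP] := dom k.+1.
have Ib : `](- rho), rho[%classic b by rewrite /= in_itv.
have h1 x : `](- rho), rho[%classic x -> P.-integrable setT (EFin \o f x).
  by rewrite /= in_itv/= => xr; exact: inte.
have h2 x w : `](- rho), rho[%classic x -> setT w -> derivable (f ^~ w) x 1.
  by move=> _ _; exact: (@ex_derive _ _ _ _ _ _ _ (df x w)).
have G0 w : 0 <= C * expR (r * Y w) by rewrite mulr_ge0 ?expR_ge0// ltW.
have intG : P.-integrable setT (EFin \o (fun w => C * expR (r * Y w))).
  exact: (integrableZl measurableT C intr).
have h3 x w : `](- rho), rho[%classic x -> setT w -> `|partial1of2 f x w| <= C * expR (r * Y w).
  rewrite /= in_itv/= => xr _; rewrite d1f ger0_norm ?CP//.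
  by rewrite mulr_ge0 ?expR_ge0 ?exprn_ge0// ltW.
have D := derivable_under_integral measurableT Ib h1 h2 G0 intG h3.
have V := differentiation_under_integral measurableT Ib h1 h2 G0 intG h3.
apply: DeriveDef; first exact: D.
by rewrite -derive1E V; apply: eq_Rintegral => w _; rewrite d1f.
Qed.

End Mgf.

Section Taylor.
Context (R : realType).

(** Second-order Taylor formula with Peano remainder: the remainder has derivative
[o(b)] near [0], and the mean value theorem gains one more factor [b]. *)
Lemma taylor2_peano (f f' : R -> R) (s : R) :
  (\forall b \near (0 : R), is_derive (b : R) 1 f (f' b)) -> is_derive (0 : R) 1 f' s ->
  forall eps : R, 0 < eps -> \forall b \near (0 : R),
    `|f b - f 0 - f' 0 * b - s / 2 * b ^+ 2| <= eps * b ^+ 2.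
Proof.
move=> df d2 eps eps0.
have near1 : \forall b \near (0 : R), `|f' b - f' 0 - s * b| <= eps * `|b|.
  have [dd ds] := d2.
  have : h^-1 *: (f' (h + 0) - f' 0) @[h --> (0 : R)^'] --> s.
    rewrite -ds; move: dd; rewrite /derivable /derive.
    have -> // : (fun h : R => h^-1 *: ((f' \o shift 0) (h *: 1) - f' 0)) =
        (fun h => h^-1 *: (f' (h + 0) - f' 0)).
    by apply/funext => h /=; rewrite scaler1.
  move=> /cvgrPdist_le/(_ _ eps0); rewrite near_withinE.
  apply: filterS => h hP; have [->|h0] := eqVneq h 0.
    by rewrite subrr mulr0 subrr normr0 mulr0.
  have := hP h0; rewrite addr0 => {}hP.
  have -> : f' h - f' 0 - s * h = - (s - h^-1 *: (f' h - f' 0)) * h.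
    by rewrite /GRing.scale/=; field.
  by rewrite normrM normrN ler_pM2r// normr_gt0.
have [e /= e0 eP] : exists2 e : R, 0 < e & forall b : R, `|b| < e ->
    is_derive (b : R) 1 f (f' b) /\ `|f' b - f' 0 - s * b| <= eps * `|b|.
  have both : \forall b \near (0 : R), is_derive (b : R) 1 f (f' b) /\
      `|f' b - f' 0 - s * b| <= eps * `|b|.
    by apply: filterS2 df near1 => b.
  have /nbhs_ballP[e e0 eP] := both.
  by exists e => // b be; apply: eP; rewrite /ball/= sub0r normrN.
pose g b := f b - f 0 - f' 0 * b - s / 2 * b ^+ 2.
have dg (b : R) : `|b| < e -> is_derive b 1 g (f' b - f' 0 - s * b).
  move=> /eP[dfb _]; rewrite /g.
  apply: is_derive_eq.
  by rewrite /GRing.scale/=; field.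
near=> b.
have be : `|b| < e by near: b; apply/nbhs_ballP; exists e => //= x; rewrite /ball/= sub0r normrN.
have mvt (u v : R) : u <= v -> -e < u -> v < e ->
    exists2 c, c \in `[u, v] & g v - g u = (f' c - f' 0 - s * c) * (v - u).
  move=> uv eu ve; apply: MVT_segment => //.
    by move=> x; rewrite in_itv/= => /andP[ux xv]; apply: dg; rewrite ltr_norml; lra.
  apply: derivable_within_continuous => x; rewrite in_itv/= => /andP[ux xv].
  have xe : `|x| < e by rewrite ltr_norml; lra.
  exact: (@ex_derive _ _ _ _ _ _ _ (dg x xe)).
have g0 : g 0 = 0 by rewrite /g; ring.
have bound c : `|c| <= `|b| -> `|(f' c - f' 0 - s * c) * b| <= eps * b ^+ 2.
  move=> cb; have [_ cP] := eP c (le_lt_trans cb be).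
  rewrite normrM -[b ^+ 2]real_normK ?num_real// expr2 mulrA.
  by rewrite ler_wpM2r// (le_trans cP)// ler_wpM2l// ltW.
rewrite -/(g b); move: (be); rewrite ltr_norml => /andP[eb1 eb2].
have [b0|b0] := leP 0 b.
  have [c] := mvt 0 b b0 ltac:(lra) eb2.
  rewrite in_itv/= => /andP[c0 cb]; rewrite g0 !subr0 => ->.
  by apply: bound; rewrite !ger0_norm//.
have [c] := mvt b 0 (ltW b0) eb1 ltac:(lra).
rewrite in_itv/= => /andP[c0 cb]; rewrite g0 !sub0r mulrN => /oppr_inj ->.
by apply: bound; rewrite !ler0_norm ?lerN2// ltW.
Unshelve. all: end_near. Qed.

End Taylor.

Section LogMgfExpansion.
Context (R : realType) d (T : measurableType d) (P : probability T R).

(** Near [0] the logarithmic moment generating function is the logarithm of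
[exp_moment P Y 0], which is positive there by continuity and twice
differentiable at [0]. *)
Lemma log_mgf_expansion (Y : {RV P >-> R}) (Y0 : forall w, 0 < Y w) :
  interior (log_mgf_dom Y) 0 ->
  (\forall b \near (0 : R), 'M_P Y b = (expR (log_mgf_real Y b))%:E) /\
  (forall eps : R, 0 < eps -> \forall b \near (0 : R),
     `|log_mgf_real Y b - log_mgf'0 Y * b - log_mgf''0 Y / 2 * b ^+ 2|
       <= eps * b ^+ 2).
Proof.
move=> /nbhs_ballP[e /= e0 eP].
have mY : measurable_fun setT Y by [].
have Mfin (b : R) : `|b| < e -> 'M_P Y b \is a fin_num.
  move=> be; have : log_mgf_dom Y b by apply: eP; rewrite /ball/= sub0r normrN.
  have M0 : (0 <= 'M_P Y b)%E.
    by rewrite /mmt_gen_fun unlock; apply: integral_ge0 => w _; rewrite lee_fin expR_ge0.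
  rewrite /log_mgf_dom/= /log_mgf ge0_fin_numE//.
  by case: ('M_P Y b) => [r| |]//=; rewrite ltry.
have ME (b : R) : `|b| < e -> 'M_P Y b = (exp_moment P Y 0 b)%:E.
  move=> be; rewrite -(fineK (Mfin b be)); congr EFin.
  rewrite /exp_moment /Rintegral /mmt_gen_fun unlock; congr fine.
  by apply: eq_integral => w _ /=; rewrite expr0 mul1r mulrC.
have e20 : 0 < e / 2 by rewrite divr_gt0.
have inte : P.-integrable setT (fun w => (expR (e / 2 * Y w))%:E).
  apply/integrableP; split.
    by apply/measurable_EFinP; apply: measurableT_comp => //; exact: measurable_funM.
  have /Mfin : `|e / 2| < e by rewrite gtr0_norm//; lra.
  rewrite ge0_fin_numE; last first.
    by rewrite /mmt_gen_fun unlock; apply: integral_ge0 => w _; rewrite lee_fin expR_ge0.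
  apply: le_lt_trans; rewrite /mmt_gen_fun unlock le_eqVlt; apply/orP; left; apply/eqP.
  by apply: eq_integral => w _ /=; rewrite ger0_norm ?expR_ge0// mulrC.
have dF k (b : R) : `|b| < e / 2 ->
    is_derive b 1 (exp_moment P Y k) (exp_moment P Y k.+1 b).
  by rewrite ltr_norml => be; exact: (exp_moment_derive mY Y0 k e20 inte be).
have F00 : exp_moment P Y 0 0 = 1.
  rewrite /exp_moment; under eq_Rintegral => w _ do rewrite expr0 mul0r expR0 mul1r.
  rewrite /Rintegral integral_cst// mul1e.
  by transitivity (fine (1%E : \bar R)) => //; congr fine; exact: probability_setT.
have near_e : \forall b \near (0 : R), `|b| < e / 2.
  by apply/nbhs_ballP; exists (e / 2) => //= x; rewrite /ball/= sub0r normrN.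
have near_F : \forall b \near (0 : R), 0 < exp_moment P Y 0 b.
  have d0 := @ex_derive _ _ _ _ _ _ _ (dF 0%N 0 ltac:(by rewrite normr0)).
  have := differentiable_continuous ((derivable1_diffP _ _).1 d0).
  by move/cvgr_gt; apply; rewrite F00.
have near_M : \forall b \near (0 : R), 'M_P Y b = (exp_moment P Y 0 b)%:E /\ 0 < exp_moment P Y 0 b.
  by near do (split; [apply: ME; apply: (@lt_trans _ _ (e / 2)); last lra|]).
have near_phi : \forall b \near (0 : R), log_mgf_real Y b = ln (exp_moment P Y 0 b).
  apply: filterS near_M => b [Mb Fb].
  by rewrite /log_mgf_real /log_mgf Mb lne_EFin.
split.
  by apply: filterS2 near_M near_phi => b [-> Fb] ->; rewrite lnK.
have dphi : \forall b \near (0 : R), is_derive (b : R) 1 (log_mgf_real Y)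
    (exp_moment P Y 1 b / exp_moment P Y 0 b).
  near=> b.
  have bF : 0 < exp_moment P Y 0 b by near: b.
  have be : `|b| < e / 2 by near: b.
  have := @is_derive1_comp _ (@ln R) (exp_moment P Y 0) b _ _ (is_derive1_ln bF) (dF 0%N b be).
  rewrite mulrC; apply: near_eq_is_derive.
  near: b; apply: filterS (nbhs_interior near_phi) => b.
  by apply: filterS => c ->.
have phi0 : log_mgf_real Y 0 = 0.
  by rewrite (nbhs_singleton near_phi) F00 ln1.
move=> eps eps0.
have : \forall b \near (0 : R),
    `|log_mgf_real Y b - log_mgf_real Y 0 - log_mgf'0 Y * b - log_mgf''0 Y / 2 * b ^+ 2|
       <= eps * b ^+ 2; last by apply: filterS => b; rewrite phi0 subr0.
have H := @taylor2_peano _ (log_mgf_real Y) (derive1 (log_mgf_real Y)) (log_mgf''0 Y).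
rewrite /log_mgf'0; apply: H; last exact: eps0.
  apply: filterS dphi => b db.
  apply: DeriveDef; first exact: (@ex_derive _ _ _ _ _ _ _ db).
  by rewrite derive1E.
apply: DeriveDef; last by rewrite -derive1E.
apply: (@near_eq_derivable _ _ _ (fun b => exp_moment P Y 1 b / exp_moment P Y 0 b)).
  apply: filterS dphi => b db.
  by rewrite derive1E (@derive_val _ _ _ _ _ _ _ db).
apply: derivableM.
  exact: (@ex_derive _ _ _ _ _ _ _ (dF 1%N 0 ltac:(by rewrite normr0))).
apply: derivableV; first by rewrite F00 oner_neq0.
exact: (@ex_derive _ _ _ _ _ _ _ (dF 0%N 0 ltac:(by rewrite normr0))).
Unshelve. all: end_near. Qed.

End LogMgfExpansion.

(** * Moment generating functions of weighted sums *)

Section Independence.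
Import HBNNSimple.
Context d (T : measurableType d) (R : realType) (P : probability T R).
Local Open Scope ereal_scope.

(** Independence tested on indicators extends to nonnegative functions by linearity
and monotone convergence.  Finiteness of the integral of [W] is what allows the
limit to be taken inside the product of extended reals. *)
Lemma ge0_integral_indep_comp (W : T -> R) (Y : {RV P >-> R}) (f : R -> R) :
  measurable_fun setT W -> (forall w, 0 <= W w)%R ->
  \int[P]_w (W w)%:E < +oo ->
  (forall B, measurable B ->
    \int[P]_w (W w * \1_B (Y w))%:E = \int[P]_w (W w)%:E * P (Y @^-1` B)) ->
  measurable_fun setT f -> (forall r, 0 <= f r)%R ->
  \int[P]_w (W w * f (Y w))%:E = \int[P]_w (W w)%:E * \int[P]_w (f (Y w))%:E.
Proof.
move=> mW W0 Woo indWY mf f0.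
have mfE : measurable_fun setT (EFin \o f) by exact/measurable_EFinP.
pose g := nnsfun_approx measurableT mfE.
have g0 n r : (0 <= g n r)%R by [].
have mgY n : measurable_fun setT (fun w => g n (Y w)).
  by apply: measurableT_comp.
have simple n : \int[P]_w (W w * g n (Y w))%:E
    = \int[P]_w (W w)%:E * \int[P]_w (g n (Y w))%:E.
  have term0 y r : (0 <= y * \1_(g n @^-1` [set y]) r)%R.
    have [y0|y0] := leP 0%R y; first by rewrite mulr_ge0.
    by rewrite preimage_nnfun0// indic0 mulr0.
  have mA y : measurable (g n @^-1` [set y]) by [].
  have mI y : measurable_fun setT (fun w => \1_(g n @^-1` [set y]) (Y w) : R).
    have mi : measurable_fun setT (\1_(g n @^-1` [set y]) : R -> R) by [].
    exact: (measurableT_comp mi).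
  have mterm y : measurable_fun setT
      (fun w => (y * \1_(g n @^-1` [set y]) (Y w))%R).
    exact: measurable_funM.
  have gE w : g n (Y w) =
      (\sum_(y \in range (g n)) (y * \1_(g n @^-1` [set y]) (Y w)))%R.
    by rewrite fimfunE.
  have WgE w : (W w * g n (Y w))%:E =
      \sum_(y \in range (g n)) (W w * (y * \1_(g n @^-1` [set y]) (Y w)))%:E.
    by rewrite gE EFinM -fsumEFin// ge0_mule_fsumr// => y; rewrite lee_fin.
  under eq_integral => w _ do rewrite WgE.
  rewrite ge0_integral_fsum//; last 2 first.
  - by move=> y; apply/measurable_EFinP/measurable_funM.
  - by move=> y w _; rewrite lee_fin mulr_ge0.
  have {}gE w : (g n (Y w))%:E =
      \sum_(y \in range (g n)) (y * \1_(g n @^-1` [set y]) (Y w))%:E.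
    by rewrite gE fsumEFin.
  under [X in _ = _ * X]eq_integral => w _ do rewrite gE.
  rewrite [X in _ = _ * X]ge0_integral_fsum//; last 2 first.
  - by move=> y; exact/measurable_EFinP.
  - by move=> y w _; rewrite lee_fin.
  rewrite ge0_mule_fsumr; last by move=> y; apply: integral_ge0 => w _; rewrite lee_fin.
  apply: eq_fsbigr => y _.
  have [y0|y0] := leP 0%R y; last first.
    rewrite preimage_nnfun0//.
    under eq_integral => w _ do rewrite indic0 !mulr0.
    under [X in _ = _ * X]eq_integral => w _ do rewrite indic0 mulr0.
    by rewrite !integral0 mule0.
  under eq_integral => w _ do rewrite mulrCA EFinM.
  rewrite ge0_integralZl//; last 2 first.
  - exact/measurable_EFinP/measurable_funM.
  - by move=> w _; rewrite lee_fin mulr_ge0.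
  under [X in _ = _ * X]eq_integral => w _ do rewrite EFinM.
  rewrite [X in _ = _ * X]ge0_integralZl//; last first.
    exact/measurable_EFinP.
  rewrite indWY// muleCA; congr (_ * (_ * _)).
  transitivity (\int[P]_w (\1_(Y @^-1` (g n @^-1` [set y])) w)%:E); last by [].
  by rewrite integral_indic ?setIT//; exact: measurable_funPTI.
have g_nd r : {homo (fun n => g n r) : n m / (n <= m)%N >-> (n <= m)%R}.
  by move=> n m nm; have /lefP := nd_nnsfun_approx measurableT mfE nm; apply.
have g_cvg r : (g n r)%:E @[n --> \oo] --> (f r)%:E.
  by apply: (cvg_nnsfun_approx measurableT mfE) => // x _; rewrite lee_fin.
have mfY : measurable_fun setT (fun w => f (Y w)) by exact: measurableT_comp.
have cvgL : \int[P]_w (W w * g n (Y w))%:E @[n --> \oo] -->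
    \int[P]_w (W w * f (Y w))%:E.
  have -> : \int[P]_w (W w * f (Y w))%:E =
      \int[P]_w limn (fun n => (W w * g n (Y w))%:E).
    apply: eq_integral => w _; apply/esym/cvg_lim => //.
    by under eq_fun do rewrite EFinM; rewrite EFinM; exact: cvgeZl.
  apply: cvg_monotone_convergence => //.
  - by move=> n; exact/measurable_EFinP/measurable_funM.
  - by move=> n w _; rewrite lee_fin mulr_ge0.
  - by move=> w _ n m nm; rewrite lee_fin ler_wpM2l// g_nd.
have cvgR : \int[P]_w (g n (Y w))%:E @[n --> \oo] --> \int[P]_w (f (Y w))%:E.
  have -> : \int[P]_w (f (Y w))%:E = \int[P]_w limn (fun n => (g n (Y w))%:E).
    by apply: eq_integral => w _; apply/esym/cvg_lim.
  apply: cvg_monotone_convergence => //.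
  - by move=> n; exact/measurable_EFinP.
  - by move=> n w _; rewrite lee_fin.
  - by move=> w _ n m nm; rewrite lee_fin g_nd.
move: cvgL; under eq_fun => n do rewrite simple.
move=> cvgL; apply: (cvg_unique _ cvgL) => //.
by apply: cvgeZl => //; rewrite ge0_fin_numE//; apply: integral_ge0 => w _; rewrite lee_fin.
Qed.

Lemma prod_indic (n : nat) (A : nat -> set T) w :
  (\prod_(i < n) \1_(A i) w = \1_(\bigcap_(i in `I_n) A i) w :> R)%R.
Proof.
have [Aw|nAw] := pselect ((\bigcap_(i in `I_n) A i) w).
  rewrite [RHS]indicE mem_set//= big1// => i _.
  by rewrite indicE mem_set//; exact: (Aw i (ltn_ord i)).
rewrite [RHS]indicE memNset//=.
have [i iN nAi] : exists2 i : nat, (i < n)%N & ~ A i w.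
  apply: contrapT => h; apply: nAw => i /= ilt.
  by apply: contrapT => nAi; apply: h; exists i.
by rewrite (bigD1 (Ordinal iN))//= indicE memNset// mul0r.
Qed.

(** The definition of independence is the case where every [h i] is an indicator.
General functions are introduced one index at a time, the remaining ones still
being indicators, with [ge0_integral_indep_comp] at each stage. *)
Lemma ge0_integral_prod_indep (X : nat -> {RV P >-> R}) (n : nat) (h : nat -> R -> R) :
  mutually_independent X ->
  (forall i, measurable_fun setT (h i)) -> (forall i r, 0 <= h i r)%R ->
  (forall i, \int[P]_w (h i (X i w))%:E < +oo) ->
  \int[P]_w (\prod_(i < n) h i (X i w))%R%:E =
  \prod_(i < n) \int[P]_w (h i (X i w))%:E.
Proof.
move=> indX.
have mX B i : measurable B -> measurable (X i @^-1` B).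
  by move=> mB; exact: measurable_funPTI.
have integral_1B B i : measurable B ->
    \int[P]_w (\1_B (X i w))%:E = P (X i @^-1` B).
  move=> mB; transitivity (\int[P]_w (\1_(X i @^-1` B) w)%:E) => //.
  by rewrite integral_indic ?setIT//; exact: mX.
suff step (k : nat) (h' : nat -> R -> R) :
    (forall i : nat, (i < n)%N -> (k <= i)%N -> exists2 B, measurable B & h' i = \1_B) ->
    (forall i, measurable_fun setT (h' i)) -> (forall i r, 0 <= h' i r)%R ->
    (forall i, \int[P]_w (h' i (X i w))%:E < +oo) ->
    \int[P]_w (\prod_(i < n) h' i (X i w))%R%:E =
    \prod_(i < n) \int[P]_w (h' i (X i w))%:E.
  by apply: (step n) => i ilt; rewrite leqNgt ilt.
(* [k] counts the indices at which [h] is arbitrary. *)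
elim: k h' => [|k IH] {}h hB mh h0 hoo.
  have /choice[B BP] : forall i : nat, exists B : set R, measurable B /\ ((i < n)%N -> h i = \1_B).
    move=> i; have [ilt|_] := ltnP i n; last by exists setT.
    by have [//|B mB hE] := hB i ilt; exists B.
  have mB i : measurable (B i) by case: (BP i).
  have hE i : (i < n)%N -> h i = \1_(B i) by case: (BP i).
  have := indX [fset i in iota 0 n]%fset B mB.
  have -> : [set` [fset i in iota 0 n]%fset] = `I_n.
    by apply/seteqP; split => i /=; rewrite inE/= mem_iota add0n.
  rewrite (perm_big (iota 0 n)); last first.
    by apply: uniq_perm; rewrite ?fset_uniq ?iota_uniq// => i; rewrite inE.
  rewrite -[in iota _ _](subn0 n) big_mkord => indXB.
  rewrite [RHS](eq_bigr (fun i : 'I_n => P (X i @^-1` B i))); last first.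
    by move=> i _; rewrite hE// integral_1B.
  rewrite -indXB.
  under eq_integral => w _.
    rewrite (eq_bigr (fun i : 'I_n => \1_(X i @^-1` B i) w)); last first.
      by move=> i _; rewrite hE.
    rewrite (prod_indic n (fun i => X i @^-1` B i)).
    over.
  by rewrite integral_indic ?setIT//; apply: bigcap_measurableType => i _; exact: mX.
pose upd B i : R -> R := if i == k then \1_B else h i.
have updk B : upd B k = \1_B by rewrite /upd eqxx.
have updN B i : i != k -> upd B i = h i by rewrite /upd => /negbTE ->.
have IHupd B : measurable B -> \int[P]_w (\prod_(i < n) upd B i (X i w))%R%:E =
    \prod_(i < n) \int[P]_w (upd B i (X i w))%:E.
  move=> mB; apply: IH.
  - move=> i ilt ki; have [->|ik] := eqVneq i k; first by exists B => //; rewrite updk.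
    by rewrite updN//; apply: hB => //; lia.
  - by move=> i; have [->|ik] := eqVneq i k; rewrite ?updk ?updN.
  - by move=> i r; have [->|ik] := eqVneq i k; rewrite ?updk ?updN.
  - move=> i; have [->|ik] := eqVneq i k; last by rewrite updN.
    rewrite updk integral_1B//.
    by rewrite (le_lt_trans (probability_le1 _ _)) ?ltry//; exact: mX.
have [nk|kn] := leqP n k.
  have eqh (i : 'I_n) : h i = upd setT i.
    by rewrite updN//; move: (ltn_ord i) nk; lia.
  under eq_integral => w _ do under eq_bigr => i _ do rewrite eqh.
  under [RHS]eq_bigr => i _ do rewrite eqh.
  exact: IHupd.
pose K := Ordinal kn.
have ordK (i : 'I_n) : i != K -> (i : nat) != k by [].
pose W w := (\prod_(i < n | i != K) h i (X i w))%R.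
pose c := \prod_(i < n | i != K) \int[P]_w (h i (X i w))%:E.
have IHW B : measurable B -> \int[P]_w (W w * \1_B (X k w))%:E = c * P (X k @^-1` B).
  move=> mB; have := IHupd B mB.
  rewrite (bigD1 K)//= updk integral_1B// => IHB.
  transitivity (P (X k @^-1` B) * c); last by rewrite muleC.
  have -> : c = \prod_(i < n | i != K) \int[P]_w (upd B i (X i w))%:E.
    by apply: eq_bigr => i iK; rewrite (updN _ _ (ordK _ iK)).
  rewrite -IHB; apply: eq_integral => w _.
  rewrite (bigD1 K)//= updk mulrC; congr (_ * _)%:E.
  by apply: eq_bigr => i iK; rewrite (updN _ _ (ordK _ iK)).
have cE : \int[P]_w (W w)%:E = c.
  have := IHW setT measurableT.
  rewrite preimage_setT probability_setT mule1 => <-.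
  by apply: eq_integral => w _; rewrite indicT mulr1.
under eq_integral => w _ do rewrite (bigD1 K)//= mulrC.
rewrite [RHS](bigD1 K)//= muleC -/c -cE.
apply: ge0_integral_indep_comp => //.
- under eq_fun do rewrite -big_filter.
  by apply: measurable_prod => i _; exact: measurableT_comp.
- by move=> w; apply: prodr_ge0.
- rewrite -ge0_fin_numE ?cE; last first.
    by apply: prode_ge0 => i _; apply: integral_ge0 => w _; rewrite lee_fin.
  apply: prode_fin_num => i _.
  by rewrite ge0_fin_numE//; apply: integral_ge0 => w _; rewrite lee_fin.
- by move=> B mB; rewrite IHW// cE.
Qed.

Lemma mmt_gen_funE (Y : {RV P >-> R}) b :
  'M_P Y b = \int[P]_w (expR (b * Y w))%:E.
Proof. by rewrite /mmt_gen_fun unlock; apply: eq_integral => w _ /=; rewrite mulrC. Qed.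

Lemma iid_mmt_gen_fun (X : nat -> {RV P >-> R}) b i :
  identically_distributed X -> 'M_P (X i) b = 'M_P (X 0%N) b.
Proof.
move=> idX; rewrite !mmt_gen_funE.
have me : measurable_fun setT (fun r : R => (expR (b * r))%:E).
  by apply/measurable_EFinP; apply: measurableT_comp => //; exact: mulrl_measurable.
have := @ge0_integral_distribution _ _ _ _ _ P (X i) _ me.
rewrite /comp => <-; last by move=> r; rewrite lee_fin expR_ge0.
have := @ge0_integral_distribution _ _ _ _ _ P (X 0%N) _ me.
rewrite /comp => <-; last by move=> r; rewrite lee_fin expR_ge0.
by apply: eq_measure_integral => B mB _; exact: idX.
Qed.

Lemma mmt_gen_fun_wsum (X : nat -> {RV P >-> R}) n (b : nat -> R) :
  iid X -> (forall i, 'M_P (X 0%N) (b i) < +oo) ->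
  \int[P]_w (expR (\sum_(i < n) b i * X i w))%:E =
  \prod_(i < n) 'M_P (X 0%N) (b i).
Proof.
move=> [indX idX] boo.
under eq_integral => w _ do rewrite expR_sum.
rewrite (ge0_integral_prod_indep n (h := fun i r => expR (b i * r)))//.
- by apply: eq_bigr => i _; rewrite -mmt_gen_funE iid_mmt_gen_fun.
- by move=> i; apply: measurableT_comp => //; exact: mulrl_measurable.
- by move=> i; rewrite -mmt_gen_funE iid_mmt_gen_fun.
Qed.
End Independence.

(** * Hitting time and area of a renewal path *)

Lemma exists_nat_ceil (R : realType) (x : R) : 0 < x ->
  exists n : nat, n%:R < x /\ x <= n.+1%:R.
Proof.
move=> x0; have /andP[t1 t2] := Num.Theory.truncn_itv (ltW x0).
move: t1; rewrite le_eqVlt => /predU1P[tx|tx]; last first.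
  by eexists; split; [exact: tx|exact: ltW].
move: tx; case: (Num.truncn x) => [tx|n tx]; first by rewrite -tx ltxx in x0.
by exists n; rewrite -tx; split => //; rewrite ltr_nat.
Qed.

Section RenewalPath.
Context (R : realType) (Omega : Type) (X : nat -> Omega -> R) (w : Omega).
Hypothesis X_gt0 : forall n, 0 < X n w.
Local Notation S n := (arrival X n w).

Lemma arrivalS n : S n.+1 = S n + X n w.
Proof. by rewrite /arrival big_ord_recr. Qed.

Lemma arrival_lt m n : (m < n)%N -> S m < S n.
Proof.
elim: n => // n IH; rewrite ltnS leq_eqVlt arrivalS => /predU1P[->|/IH mn].
  by rewrite ltrDl.
by rewrite (lt_trans mn)// ltrDl.
Qed.

Lemma arrival_le m n : (m <= n)%N -> S m <= S n.
Proof. by rewrite leq_eqVlt => /predU1P[->//|/arrival_lt/ltW]. Qed.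

Lemma arrival_ge0 n : 0 <= S n.
Proof. by apply: le_trans (arrival_le (leq0n n)); rewrite /arrival big_ord0. Qed.

(** Before the arrival [m.+1] only the first [m] terms of the series survive, so the
renewal function is finite there. *)
Lemma renewal_before m t : t < S m.+1 ->
  renewal X t w = (\sum_(1 <= k < m.+1) (S k <= t)%R%:R)%:E.
Proof.
move=> tm; rewrite /renewal (nneseries_split 1%N m); last by move=> k _; rewrite lee_fin.
rewrite [X in (_ + X)%E]eseries0 ?adde0 ?add1n ?sumEFin// => k mk _.
by rewrite leNgt (lt_le_trans tm)//; exact: arrival_le.
Qed.

Lemma renewal_after n t : S n <= t -> (n%:R%:E <= renewal X t w)%E.
Proof.
move=> nt; apply: le_trans (nneseries_lim_ge n.+1 _); last first.
  by move=> k _ _; rewrite lee_fin.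
rewrite sumEFin lee_fin (eq_big_nat _ _ (F2 := fun=> 1)); last first.
  by move=> k /andP[_ kn]; rewrite (le_trans _ nt)// arrival_le.
by rewrite sumr_const_nat subn1.
Qed.

Lemma hittingE x n : n%:R < x -> x <= n.+1%:R -> hitting X x w = S n.+1.
Proof.
move=> nx xn; rewrite /hitting.
suff -> : [set t : R | 0 <= t /\ (x%:E - renewal X t w <= 0)%E] = `[S n.+1, +oo[%classic.
  by rewrite inf_itv// bnd_simp.
apply/seteqP; split => t /=; rewrite in_itv/= andbT.
  move=> [t0]; apply: contraTle => tn; rewrite -ltNge (renewal_before tn) -EFinB lte_fin subr_gt0.
  apply: le_lt_trans nx; apply: (@le_trans _ _ (\sum_(1 <= k < n.+1) 1)).
    by apply: ler_sum => k _; case: (arrival X k w <= t).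
  by rewrite sumr_const_nat subn1.
move=> nt; split; first exact: le_trans (arrival_ge0 _) nt.
rewrite sube_le0; apply: le_trans (renewal_after nt).
by rewrite lee_fin.
Qed.

(** Summation by parts: the gap [S n - S k] is the sum of the interarrival times of
indices [k <= i < n], and [X i] occurs in exactly [i] of the nonempty gaps. *)
Lemma sum_gap x n : x * S n - \sum_(1 <= k < n.+1) (S n - S k) =
  \sum_(i < n) (x - i%:R) * X i w.
Proof.
elim: n => [|n IH].
  by rewrite big_geq// big_ord0 /arrival big_ord0 mulr0 subr0.
rewrite big_ord_recr/= -IH big_nat_recr//= subrr addr0 arrivalS.
have -> : \sum_(1 <= k < n.+1) (S n + X n w - S k) =
    \sum_(1 <= k < n.+1) (S n - S k) + n%:R * X n w.
  under eq_bigr => k _ do rewrite addrAC.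
  by rewrite big_split/= sumr_const_nat subn1 mulr_natl.
ring.
Qed.

(** The unit jump at [S k] removes [S n.+1 - S k] from the area [x * S n.+1] of the
rectangle. *)
Lemma areaE x n : n%:R < x -> x <= n.+1%:R ->
  area X x w = \sum_(i < n.+1) (x - i%:R) * X i w.
Proof.
move=> nx xn; rewrite /area (hittingE nx xn) -sum_gap.
set s := S n.+1.
have mI k : measurable_fun `[0, s] (fun t : R => ((S k <= t)%R%:R : R)%:E).
  apply/measurable_EFinP.
  have -> : (fun t : R => (S k <= t)%R%:R : R) = \1_(`[S k, +oo[%classic).
    by apply/funext => t; rewrite indicE mem_setE in_itv/= andbT.
  exact: measurable_funTS.
have intI k : (k <= n.+1)%N ->
    (\int[lebesgue_measure]_(t in `[0%R, s]) ((S k <= t)%R%:R)%:E = (s - S k)%:E)%E.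
  move=> kn; transitivity (\int[lebesgue_measure]_(t in `[0%R, s]) (\1_(`[S k, +oo[%classic) t)%:E)%E.
    by apply: eq_integral => t _; rewrite indicE mem_setE in_itv/= andbT.
  rewrite integral_indic//.
  transitivity (lebesgue_measure (`[S k, s]%classic : set R)).
    congr (_ _); apply/seteqP; split => t /=; rewrite !in_itv/= ?andbT.
      by move=> [-> /andP[_ ->]].
    by move=> /andP[kt ts]; split => //; rewrite ts (le_trans (arrival_ge0 k)).
  rewrite lebesgue_measure_itv/= lte_fin; case: ltP => // sk.
  have -> : s = S k by apply/le_anti/andP; split => //; exact: arrival_le.
  by rewrite subrr.
have intsum : (\int[lebesgue_measure]_(t in `[0%R, s]) (\sum_(1 <= k < n.+2) (S k <= t)%R%:R)%:E =
    (\sum_(1 <= k < n.+2) (s - S k))%:E)%E.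
  under eq_integral => t _ do rewrite -sumEFin.
  rewrite ge0_integral_sum//.
  rewrite -sumEFin; apply: eq_big_nat => k /andP[_ kn]; exact: intI.
have -> : (\int[lebesgue_measure]_(t in `[0%R, s]) (x%:E - renewal X t w) =
    \int[lebesgue_measure]_(t in `[0%R, s])
      (x%:E - (\sum_(1 <= k < n.+2) (S k <= t)%R%:R)%:E))%E.
  apply: eq_integral => t; rewrite inE/= in_itv/= => /andP[_ ts].
  by rewrite (@renewal_before n.+1)// (le_lt_trans ts)// arrival_lt.
rewrite integralB//; last 2 first.
- apply/integrableP; split; first exact: measurable_cst.
  by rewrite integral_cst//= lebesgue_measure_itv/= lte_fin; case: ifP => _; rewrite ?mule0 -?EFinB -?EFinM ltry.
- apply/integrableP; split.
    apply/measurable_EFinP; apply: measurable_sum => k.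
    by apply/measurable_EFinP; exact: mI.
  under eq_integral => t _.
    rewrite abse_EFin ger0_norm; last by apply: sumr_ge0.
    over.
  by rewrite intsum ltry.
rewrite intsum integral_cst//= lebesgue_measure_itv/= lte_fin.
have [s0|s0] := ltP 0 s; first by rewrite oppr0 adde0.
have -> : s = 0 by apply/le_anti; rewrite s0 arrival_ge0.
by rewrite mule0 mulr0.
Qed.

End RenewalPath.

(** * Asymptotics of the scaled cumulants *)

Section Weights.
Context (R : realType).

(** The coefficient of the [i]-th interarrival time in the functional [(t1, t2)] of
the pair (hitting time, area), up to the common scaling factor. *)
Definition weight (t1 t2 x : R) (i : nat) : R := t1 + t2 * (x - i%:R) / x.

Lemma sum_nat_ord n : \sum_(i < n.+1) (i%:R : R) = n%:R * (n%:R + 1) / 2.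
Proof.
elim: n => [|n IH]; first by rewrite big_ord1 /= !mul0r.
by rewrite big_ord_recr/= IH -!natr1; field.
Qed.

Lemma sum_sqr_ord n :
  \sum_(i < n.+1) (i%:R ^+ 2 : R) = n%:R * (n%:R + 1) * (2 * n%:R + 1) / 6.
Proof.
elim: n => [|n IH]; first by rewrite big_ord1 /= !mul0r expr0n.
by rewrite big_ord_recr/= IH -!natr1; field.
Qed.

Lemma weightE t1 t2 x i : x != 0 -> weight t1 t2 x i = t1 + t2 - t2 / x * i%:R.
Proof. by move=> x0; rewrite /weight; field. Qed.

Lemma weight_le t1 t2 x i : 0 < x -> i%:R < x -> `|weight t1 t2 x i| <= `|t1| + `|t2|.
Proof.
move=> x0 ix; apply: (le_trans (ler_normD _ _)); rewrite lerD2l.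
have q : 0 <= (x - i%:R) / x.
  by apply: divr_ge0; [rewrite subr_ge0 ltW|exact: ltW].
rewrite -mulrA normrM ler_piMr// (ger0_norm q).
by rewrite ler_pdivrMr// mul1r lerBlDr lerDl.
Qed.

(** With [n.+1 = x + h], [0 <= h <= 1], the error of the Riemann sum is an explicit
bounded function of [h] and [1 / x]. *)
Lemma sum_weight t1 t2 x n : 1 <= x -> n%:R < x -> x <= n.+1%:R ->
  `|\sum_(i < n.+1) weight t1 t2 x i - x * (t1 + t2 / 2)| <= `|t1 + t2| + `|t2|.
Proof.
move=> x1 nx; rewrite -natr1 => xn.
have x0 : 0 < x by exact: lt_le_trans x1.
have E : \sum_(i < n.+1) weight t1 t2 x i =
    (n%:R + 1) * (t1 + t2) - t2 / x * (n%:R * (n%:R + 1) / 2).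
  rewrite (eq_bigr (fun i : 'I_n.+1 => t1 + t2 - t2 / x * i%:R)); last first.
    by move=> i _; rewrite weightE// gt_eqF.
  by rewrite sumrB -mulr_sumr sum_nat_ord sumr_const card_ord -[_ *+ n.+1]mulr_natl natr1.
rewrite E; pose h := n%:R + 1 - x.
have h01 : 0 <= h <= 1 by rewrite /h; apply/andP; split; lra.
have -> : n%:R = x + h - 1 by rewrite /h; ring.
have -> : (x + h - 1 + 1) * (t1 + t2) - t2 / x * ((x + h - 1) * (x + h - 1 + 1) / 2) -
    x * (t1 + t2 / 2) = h * (t1 + t2) - t2 * (((2 * h - 1) + h * (h - 1) / x) / 2).
  by field; rewrite gt_eqF.
move: h01 => /andP[h0 h1].
apply: (le_trans (ler_normB _ _)); apply: lerD.
  by rewrite normrM ler_piMl// ger0_norm.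
rewrite normrM ler_piMr//.
have : -1 <= h * (h - 1) / x <= 0.
  apply/andP; split; first by rewrite ler_pdivlMr//; nra.
  by rewrite pmulr_lle0 ?invr_gt0//; nra.
by move=> /andP[q1 q2]; rewrite ler_norml; apply/andP; split; lra.
Qed.

(** Same computation as for [sum_weight]; the limit is the integral of
[(t1 + t2 * u) ^+ 2] over the unit interval. *)
Lemma sum_sqr_weight t1 t2 x n : 1 <= x -> n%:R < x -> x <= n.+1%:R ->
  `|(\sum_(i < n.+1) weight t1 t2 x i ^+ 2) / x - (t1 ^+ 2 + t1 * t2 + t2 ^+ 2 / 3)|
  <= ((t1 + t2) ^+ 2 + 2 * `|(t1 + t2) * t2| + t2 ^+ 2) / x.
Proof.
move=> x1 nx; rewrite -natr1 => xn.
have x0 : 0 < x by exact: lt_le_trans x1.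
set S1 := t1 + t2.
have E : \sum_(i < n.+1) weight t1 t2 x i ^+ 2 =
    (n%:R + 1) * S1 ^+ 2 - 2 * S1 * t2 / x * (n%:R * (n%:R + 1) / 2)
    + t2 ^+ 2 / x ^+ 2 * (n%:R * (n%:R + 1) * (2 * n%:R + 1) / 6).
  rewrite (eq_bigr (fun i : 'I_n.+1 =>
      S1 ^+ 2 - 2 * S1 * t2 / x * i%:R + t2 ^+ 2 / x ^+ 2 * i%:R ^+ 2)); last first.
    by move=> i _; rewrite weightE ?gt_eqF// /S1; field; rewrite gt_eqF.
  rewrite big_split sumrB/= -!mulr_sumr sum_nat_ord sum_sqr_ord sumr_const card_ord.
  by rewrite -[S1 *+ n.+1]mulr_natl -natr1; ring.
rewrite E; pose h := n%:R + 1 - x.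
have h01 : 0 <= h <= 1 by rewrite /h; apply/andP; split; lra.
pose y := x^-1.
have y0 : 0 < y by rewrite invr_gt0.
have y1 : y <= 1 by rewrite invf_le1.
have -> : n%:R = x + h - 1 by rewrite /h; ring.
pose q1 := h.
pose q2 := (2 * h - 1) + h * (h - 1) * y.
pose q3 := (6 * h - 3) + (6 * h ^+ 2 - 6 * h + 1) * y + h * (h - 1) * (2 * h - 1) * y ^+ 2.
have -> : ((x + h - 1 + 1) * S1 ^+ 2
   - 2 * S1 * t2 / x * ((x + h - 1) * (x + h - 1 + 1) / 2) +
   t2 ^+ 2 / x ^+ 2 * ((x + h - 1) * (x + h - 1 + 1) * (2 * (x + h - 1) + 1) / 6)) / x -
  (t1 ^+ 2 + t1 * t2 + t2 ^+ 2 / 3) =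
  (S1 ^+ 2 * q1 - S1 * t2 * q2 + t2 ^+ 2 * (q3 / 6)) / x.
  by rewrite /q1 /q2 /q3 /S1 /y; field; rewrite gt_eqF.
rewrite normrM [X in _ * X <= _]gtr0_norm ?invr_gt0// ler_pM2r ?invr_gt0//.
move: h01 => /andP[h0 h1].
have hh : -1 <= h * (h - 1) <= 0 by apply/andP; split; nra.
move: hh => /andP[hh1 hh2].
have Q1 : `|q1| <= 1 by rewrite ger0_norm.
have scale (t z : R) : -1 <= t <= 1 -> 0 <= z <= 1 -> -1 <= t * z <= 1.
  by move=> /andP[? ?] /andP[? ?]; apply/andP; split; nra.
have y01 : 0 <= y <= 1 by rewrite (ltW y0).
have yy01 : 0 <= y ^+ 2 <= 1 by rewrite sqr_ge0/= expr_le1// ltW.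
have h1' : -1 <= 2 * h - 1 <= 1 by apply/andP; split; lra.
have Q2 : `|q2| <= 2.
  have /andP[? ?] : -1 <= h * (h - 1) * y <= 1.
    by apply: scale => //; apply/andP; split; lra.
  by rewrite /q2 ler_norml; apply/andP; split; lra.
have Q3 : `|q3 / 6| <= 1.
  have /andP[? ?] : -1 <= (6 * h ^+ 2 - 6 * h + 1) * y <= 1.
    apply: scale => //; have := sqr_ge0 (2 * h - 1); rewrite expr2.
    by move=> ?; apply/andP; split; lra.
  have /andP[? ?] : -1 <= h * (h - 1) * (2 * h - 1) * y ^+ 2 <= 1.
    apply: scale => //; move: h1' => /andP[? ?].
    by set t := h * (h - 1) in hh1 hh2 *; apply/andP; split; nra.
  by rewrite /q3 ler_norml; apply/andP; split; lra.
apply: (le_trans (ler_normD _ _)); apply: lerD.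
  apply: (le_trans (ler_normB _ _)); apply: lerD.
    by rewrite normrM normrX real_normK ?num_real// ler_piMr// sqr_ge0.
  by rewrite normrM mulrC ler_wpM2r.
by rewrite normrM normrX real_normK ?num_real// ler_piMr// sqr_ge0.
Qed.

End Weights.

Section Cumulant.
Context (R : realType) (a : R -> R).
Hypothesis a_gt0 : forall x : R, 0 < x -> 0 < a x.
Hypothesis a_to0 : a x @[x --> +oo] --> (0 : R).
Hypothesis xa_toy : x * a x @[x --> +oo] --> +oo.

Local Notation c x := (Num.sqrt (x * a x))^-1.

Lemma near_pinfty_ge (A : R) : \forall x \near +oo, A <= x.
Proof. by apply: nbhs_pinfty_ge; exact: num_real. Qed.

Lemma small_weight t1 t2 (r : R) : 0 < r -> \forall x \near +oo,
  forall i : nat, i%:R < x -> `|c x * weight t1 t2 x i| < r.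
Proof.
move=> r0; pose K := `|t1| + `|t2| + 1.
have K0 : 0 < K by rewrite /K; have := normr_ge0 t1; have := normr_ge0 t2; lra.
near=> x => i ix.
have x0 : 0 < x by apply: (@lt_le_trans _ _ 1) => //; near: x; exact: near_pinfty_ge.
have xa0 : 0 < x * a x by rewrite mulr_gt0// a_gt0.
have sq0 : 0 < Num.sqrt (x * a x) by rewrite sqrtr_gt0.
rewrite normrM gtr0_norm ?invr_gt0// mulrC ltr_pdivrMr//.
apply: (@lt_trans _ _ K).
  by rewrite /K (le_lt_trans (weight_le t1 t2 x0 ix))// ltrDl.
rewrite -ltr_pdivrMl// -(@ltr_pXn2r _ 2)// ?nnegrE ?sqrtr_ge0//; last first.
  by rewrite mulr_ge0 ?invr_ge0// ltW.
rewrite sqr_sqrtr ?(ltW xa0)//; near: x.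
by move/cvgryPgt : xa_toy; apply.
Unshelve. all: end_near. Qed.

(** Expanding [phi] to second order splits the difference in three: the Taylor
remainders, of total size [e1 * 2 * K ^+ 2] because [a x] times the squared scaling
factor is [1 / x]; the first-order terms, which differ from the centring by a
bounded quantity times [a x] and a factor at most [1]; and the error of the Riemann
sum of the squares. *)
Lemma cumulant_approx (phi : R -> R) (m s t1 t2 : R) : 0 <= s ->
  (forall e, 0 < e -> \forall b \near (0 : R),
    `|phi b - m * b - s / 2 * b ^+ 2| <= e * b ^+ 2) ->
  forall e : R, 0 < e -> \forall x \near +oo, forall n : nat, n%:R < x -> x <= n.+1%:R ->
  `|a x * (\sum_(i < n.+1) phi (c x * weight t1 t2 x i) - c x * x * (m * (t1 + t2 / 2)))
    - s / 2 * (t1 ^+ 2 + t1 * t2 + t2 ^+ 2 / 3)| <= e.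
Proof.
move=> s0 phiP e e0.
pose K := `|t1| + `|t2|.
have K0 : 0 <= K by rewrite addr_ge0.
pose K1 := `|m| * (`|t1 + t2| + `|t2|) + 1.
have K1_gt0 : 0 < K1 by rewrite ltr_wpDl// mulr_ge0// addr_ge0.
pose K2 := s / 2 * ((t1 + t2) ^+ 2 + 2 * `|(t1 + t2) * t2| + t2 ^+ 2) + 1.
have K2_gt0 : 0 < K2.
  rewrite ltr_wpDl// mulr_ge0 ?divr_ge0//.
  have := sqr_ge0 (t1 + t2); have := sqr_ge0 t2.
  have := normr_ge0 ((t1 + t2) * t2); lra.
(* The added [1] keeps the denominator positive when [t1 = t2 = 0]. *)
pose e1 := e / 3 / (2 * K ^+ 2 + 1).
have KK : 0 < 2 * K ^+ 2 + 1 by rewrite ltr_wpDl// mulr_ge0// sqr_ge0.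
have e1_gt0 : 0 < e1 by rewrite !divr_gt0.
have [r /= r0 rP] : exists2 r : R, 0 < r & forall b : R, `|b| < r ->
    `|phi b - m * b - s / 2 * b ^+ 2| <= e1 * b ^+ 2.
  have /nbhs_ballP[r r0 rP] := phiP _ e1_gt0.
  by exists r => // b br; apply: rP; rewrite /ball/= sub0r normrN.
near=> x => n nx xn.
have x1 : 1 <= x by near: x; exact: near_pinfty_ge.
have x0 : 0 < x by exact: lt_le_trans x1.
have a0 := a_gt0 x0.
have xa0 : 0 < x * a x by rewrite mulr_gt0.
have sq0 : 0 < Num.sqrt (x * a x) by rewrite sqrtr_gt0.
have sw : forall i : nat, i%:R < x -> `|c x * weight t1 t2 x i| < r.
  by near: x; exact: small_weight.
set cx := c x in sw *; have c0 : 0 < cx by rewrite invr_gt0.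
have c1 : cx <= 1.
  rewrite /cx invf_le1// -(@ler_pXn2r _ 2)// ?nnegrE ?sqrtr_ge0//.
  rewrite expr1n sqr_sqrtr ?(ltW xa0)// ltW//; near: x.
  by move/cvgryPgt : xa_toy; apply.
have cc : a x * cx ^+ 2 = x^-1.
  by rewrite /cx exprVn sqr_sqrtr ?(ltW xa0)//; field; rewrite !gt_eqF.
set b := weight t1 t2 x in sw *.
have small (i : 'I_n.+1) : `|phi (cx * b i) - m * (cx * b i) - s / 2 * (cx * b i) ^+ 2|
    <= e1 * (cx * b i) ^+ 2.
  apply: rP; have ix : (i : nat)%:R < x by rewrite (le_lt_trans _ nx)// ler_nat -ltnS.
  exact: sw.
have bK (i : 'I_n.+1) : b i ^+ 2 <= K ^+ 2.
  have ix : (i : nat)%:R < x by rewrite (le_lt_trans _ nx)// ler_nat -ltnS.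
  rewrite -[b i ^+ 2]real_normK ?num_real// ler_pXn2r ?nnegrE//.
  exact: weight_le.
pose B1 := \sum_(i < n.+1) b i.
pose B2 := \sum_(i < n.+1) b i ^+ 2.
pose D := \sum_(i < n.+1) (phi (cx * b i) - m * (cx * b i) - s / 2 * (cx * b i) ^+ 2).
have DE : \sum_(i < n.+1) phi (cx * b i) = D + m * cx * B1 + s / 2 * cx ^+ 2 * B2.
  rewrite /D /B1 /B2 !mulr_sumr -!big_split/=; apply: eq_bigr => i _.
  by rewrite exprMn; ring.
have -> : a x * (\sum_(i < n.+1) phi (cx * b i) - cx * x * (m * (t1 + t2 / 2)))
    - s / 2 * (t1 ^+ 2 + t1 * t2 + t2 ^+ 2 / 3) =
    a x * D + a x * cx * (m * (B1 - x * (t1 + t2 / 2)))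
    + s / 2 * (B2 / x - (t1 ^+ 2 + t1 * t2 + t2 ^+ 2 / 3)).
  have -> : B2 / x = a x * cx ^+ 2 * B2 by rewrite cc mulrC.
  by rewrite DE; ring.
have D1 : `|a x * D| <= e / 3.
  have : `|D| <= e1 * (cx ^+ 2 * B2).
    rewrite /B2 !mulr_sumr; apply: (le_trans (ler_norm_sum _ _ _)).
    by apply: ler_sum => i _; rewrite -exprMn; exact: small.
  have : B2 <= 2 * x * K ^+ 2.
    apply: (@le_trans _ _ (\sum_(i < n.+1) K ^+ 2)); first by apply: ler_sum.
    rewrite sumr_const card_ord -[leLHS]mulr_natl ler_wpM2r ?sqr_ge0//.
    by move: nx x1; rewrite -natr1; lra.
  move=> B2x Dle; rewrite normrM gtr0_norm//.
  have : a x * `|D| <= e1 * (2 * K ^+ 2).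
    apply: (@le_trans _ _ (a x * (e1 * (cx ^+ 2 * B2)))); first by rewrite ler_pM2l.
    have -> : a x * (e1 * (cx ^+ 2 * B2)) = e1 * (B2 / x).
      by rewrite [B2 / x]mulrC -cc; ring.
    by rewrite ler_pM2l// ler_pdivrMr// (le_trans B2x)//; lra.
  move=> /le_trans; apply; rewrite /e1 mulrAC ler_pdivrMr// ler_pM2l ?divr_gt0//.
  by lra.
have D2 : `|a x * cx * (m * (B1 - x * (t1 + t2 / 2)))| <= e / 3.
  rewrite normrM gtr0_norm ?mulr_gt0// normrM.
  have := sum_weight t1 t2 x1 nx xn; rewrite -/b -/B1 => B1le.
  have aK : a x <= e / 3 / K1.
    by rewrite ltW//; near: x; apply: (cvgr_lt _ a_to0); rewrite !divr_gt0.
  apply: (@le_trans _ _ (a x * K1)); last by rewrite -ler_pdivlMr.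
  rewrite -mulrA ler_pM2l// -[leRHS]mul1r ler_pM ?(ltW c0) ?mulr_ge0//.
  by rewrite /K1 (le_trans (ler_wpM2l _ B1le))// lerDl.
have D3 : `|s / 2 * (B2 / x - (t1 ^+ 2 + t1 * t2 + t2 ^+ 2 / 3))| <= e / 3.
  rewrite normrM ger0_norm ?divr_ge0//.
  have := sum_sqr_weight t1 t2 x1 nx xn; rewrite -/b -/B2 => B2le.
  have xK : K2 / (e / 3) <= x by near: x; exact: near_pinfty_ge.
  apply: (@le_trans _ _ (K2 / x)); last first.
    by rewrite ler_pdivrMr// mulrC -ler_pdivrMr// divr_gt0.
  have s2 : 0 <= s / 2 by rewrite divr_ge0.
  apply: (le_trans (ler_wpM2l s2 B2le)).
  by rewrite mulrA ler_pM2r ?invr_gt0// /K2 lerDl.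
apply: (le_trans (ler_normD _ _)).
have := ler_normD (a x * D) (a x * cx * (m * (B1 - x * (t1 + t2 / 2)))).
lra.
Unshelve. all: end_near. Qed.

End Cumulant.

(** * The rate function *)

Section Psi.
Context (R : realType) (s : R).
Hypothesis s_gt0 : 0 < s.

Definition quad (z : 'rV[R]_2) : R :=
  (2 * z 0 0 ^+ 2 - 6 * (z 0 0 * z 0 1) + 6 * z 0 1 ^+ 2) / s.

Lemma psi_starE z : psi_star s z = (quad z)%:E.
Proof.
rewrite /psi_star !big_ord_recl !big_ord0 /hatC /mat2 !mxE/=; congr EFin.
rewrite /quad; have -> : lift ord0 ord0 = 1 :> 'I_2 by exact/val_inj.
by field; rewrite gt_eqF.
Qed.

Lemma quad_ge0 z : 0 <= quad z.
Proof.
rewrite /quad divr_ge0 ?(ltW s_gt0)//.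
have -> : 2 * z 0 0 ^+ 2 - 6 * (z 0 0 * z 0 1) + 6 * z 0 1 ^+ 2 =
    2 * (z 0 0 - 3 / 2 * z 0 1) ^+ 2 + 3 / 2 * z 0 1 ^+ 2 by field.
by rewrite addr_ge0// mulr_ge0// sqr_ge0.
Qed.

Lemma continuous_quadratic (T : topologicalType) (f g : T -> R) :
  continuous f -> continuous g ->
  continuous (fun z => (2 * (f z * f z) - 6 * (f z * g z) + 6 * (g z * g z)) / s).
Proof.
move=> cf cg z; have := cf z; have := cg z => gz fz.
apply: cvgM; last exact: cvg_cst.
apply: cvgD; first apply: cvgB.
- by apply: cvgM; [exact: cvg_cst|exact: cvgM].
- by apply: cvgM; [exact: cvg_cst|exact: cvgM].
- by apply: cvgM; [exact: cvg_cst|exact: cvgM].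
Qed.

Lemma continuous_quad : continuous quad.
Proof.
have -> : quad = fun z => (2 * (z 0 0 * z 0 0) - 6 * (z 0 0 * z 0 1) + 6 * (z 0 1 * z 0 1)) / s.
  by apply/funext => z; rewrite /quad !expr2.
apply: (@continuous_quadratic _ (fun z : 'rV[R]_2 => z 0 0) (fun z => z 0 1)).
  exact: coord_continuous.
exact: coord_continuous.
Qed.

Lemma good_rate_psi_star : good_rate_function (psi_star s).
Proof.
have -> : psi_star s = EFin \o quad by apply/funext => z; rewrite psi_starE.
split.
  split; first by move=> z; rewrite lee_fin quad_ge0.
  apply/lower_semicontinuousP => r.
  have -> : [set z | (r%:E < (EFin \o quad) z)%E] = quad @^-1` [set y | r < y].
    by apply/seteqP; split => z /=; rewrite lte_fin.
  by apply: open_comp; [move=> z _; exact: continuous_quad|exact: open_gt].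
move=> eta eta0.
have -> : [set z | ((EFin \o quad) z <= eta%:E)%E] = quad @^-1` [set y | y <= eta].
  by apply/seteqP; split => z /=; rewrite lee_fin.
apply: bounded_closed_compact.
  exists (2 * s * eta + 1); split; first exact: num_real.
  move=> M hM z /= zeta.
  have se : 0 <= s * eta by rewrite mulr_ge0// ltW.
  have zz : 2 * z 0 0 ^+ 2 - 6 * (z 0 0 * z 0 1) + 6 * z 0 1 ^+ 2 <= s * eta.
    by move: zeta; rewrite /quad ler_pdivrMr// [eta * s]mulrC.
  have b0 : z 0 0 ^+ 2 <= 2 * (s * eta) by have := sqr_ge0 (z 0 1 - z 0 0 / 2); nra.
  have b1 : z 0 1 ^+ 2 <= 2 * (s * eta) by have := sqr_ge0 (z 0 0 - 3 / 2 * z 0 1); nra.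
  have ab (y : R) : y ^+ 2 <= 2 * (s * eta) -> `|y| <= M.
    by move=> y2; rewrite ler_norml; apply/andP; split; nra.
  rewrite [leLHS]/Num.Def.normr/= mx_normrE; apply/bigmax_leP => /=; split; first by lra.
  move=> [i j] _ /=; rewrite (ord1 i).
  by case: (ord2P j) => ->; exact: ab.
by apply: closed_comp; [move=> z _; exact: continuous_quad|exact: closed_le].
Qed.

Lemma covC_mul : covC s *m hatC s = 1%:M.
Proof.
apply/matrixP => i j; rewrite !mxE !big_ord_recl big_ord0 !mxE.
by case: i => -[|[|//]] ilt; case: j => -[|[|//]] jlt /=; field; rewrite gt_eqF.
Qed.

End Psi.

(** * The large deviation principle *)

Section LimitBounds.
Context (R : realType).
Local Open Scope ereal_scope.

Lemma limf_esup_le_near (f : R -> \bar R) (y : \bar R) :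
  (\forall x \near +oo%R, f x <= y) -> limf_esup f +oo%R <= y.
Proof.
move=> fy; rewrite limf_esupE; apply: ge_ereal_inf.
exists (ereal_sup (f @` [set x | f x <= y])); first by exists [set x | f x <= y].
by apply: ge_ereal_sup => _ [x /= xy <-].
Qed.

Lemma limf_einf_ge_near (f : R -> \bar R) (y : \bar R) :
  (\forall x \near +oo%R, y <= f x) -> y <= limf_einf f +oo%R.
Proof.
move=> fy; rewrite limf_einfE; apply: le_ereal_sup_tmp.
exists (ereal_inf (f @` [set x | y <= f x])); first by exists [set x | y <= f x].
by apply: le_ereal_inf_tmp => _ [x /= xy <-].
Qed.

Lemma lne_le_expR (p : \bar R) (t b : R) : (0 < b)%R -> 0 <= p -> p <= (expR (t / b))%:E ->
  b%:E * lne p <= t%:E.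
Proof.
move=> b0 p0 pt.
have : lne p <= lne (expR (t / b))%:E.
  by rewrite lee_lne// in_itv/= ?leey ?andbT ?lee_fin ?expR_ge0.
rewrite lne_EFin ?expR_gt0// expRK => h.
apply: (le_trans (lee_wpmul2l _ h)); first by rewrite lee_fin ltW.
by rewrite -EFinM mulrC divfK// gt_eqF.
Qed.

Lemma lne_ge_expR (p : \bar R) (t b : R) : (0 < b)%R -> 0 <= p -> (expR (t / b))%:E <= p ->
  t%:E <= b%:E * lne p.
Proof.
move=> b0 p0 pt.
have : lne (expR (t / b))%:E <= lne p.
  by rewrite lee_lne// in_itv/= ?leey ?andbT ?lee_fin ?expR_ge0.
rewrite lne_EFin ?expR_gt0// expRK => h.
apply: le_trans (lee_wpmul2l _ h); last by rewrite lee_fin ltW.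
by rewrite -EFinM mulrC divfK// gt_eqF.
Qed.

End LimitBounds.

Section ScaledPair.
Context (R : realType) d (Omega : measurableType d) (P : probability Omega R).
Context (X : nat -> {RV P >-> R}) (a : R -> R).
Hypothesis X_iid : iid X.
Hypothesis X_gt0 : forall n w, 0 < X n w.
Hypothesis phi_dom0 : interior (log_mgf_dom (X 0%N)) 0.
Hypothesis a_gt0 : forall x : R, 0 < x -> 0 < a x.
Hypothesis a_to0 : a x @[x --> +oo] --> (0 : R).
Hypothesis xa_toy : x * a x @[x --> +oo] --> +oo.

Let m := log_mgf'0 (X 0%N).
Let s := log_mgf''0 (X 0%N).
Hypothesis s_gt0 : 0 < s.

Let Z := scaled_pair (fun n => X n : Omega -> R) m a.
Let Z1 x w := Z x w 0 0.
Let Z2 x w := Z x w 0 1.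
Local Notation c x := (Num.sqrt (x * a x))^-1.

Lemma scaled_pair1E x w :
  Z1 x w = Num.sqrt (x * a x) * (hitting (fun n => X n : Omega -> R) x w / x - m).
Proof. by rewrite /Z1 /Z /scaled_pair !mxE. Qed.

Lemma scaled_pair2E x w :
  Z2 x w = Num.sqrt (x * a x) * (area (fun n => X n : Omega -> R) x w / x ^+ 2 - 1 / 2 * m).
Proof. by rewrite /Z2 /Z /scaled_pair !mxE. Qed.

Lemma measurable_scaled_pair x : 0 < x ->
  measurable_fun setT (Z1 x) /\ measurable_fun setT (Z2 x).
Proof.
move=> x0; have [n [nx xn]] := exists_nat_ceil x0.
have X0 w n' : 0 < (fun n => X n : Omega -> R) n' w by exact: X_gt0.
split.
  have -> : Z1 x = fun w => Num.sqrt (x * a x) * ((\sum_(i < n.+1) X i w) / x - m).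
    by apply/funext => w; rewrite scaled_pair1E (hittingE (X0 w) nx xn).
  apply: measurable_funM => //; apply: measurable_funB => //.
  by apply: measurable_funM => //; apply: measurable_sum.
have -> : Z2 x = fun w => Num.sqrt (x * a x) *
    ((\sum_(i < n.+1) (x - i%:R) * X i w) / x ^+ 2 - 1 / 2 * m).
  by apply/funext => w; rewrite scaled_pair2E (areaE (X0 w) nx xn).
apply: measurable_funM => //; apply: measurable_funB => //.
apply: measurable_funM => //; apply: measurable_sum => i.
by apply: measurable_funM.
Qed.

Lemma scaled_pair_linear t1 t2 x n w : 0 < x -> n%:R < x -> x <= n.+1%:R ->
  (t1 * Z1 x w + t2 * Z2 x w) / a x =
  \sum_(i < n.+1) c x * weight t1 t2 x i * X i w - c x * x * (m * (t1 + t2 / 2)).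
Proof.
move=> x0 nx xn; have X0 n' : 0 < (fun n => X n : Omega -> R) n' w by exact: X_gt0.
rewrite scaled_pair1E scaled_pair2E (hittingE X0 nx xn) (areaE X0 nx xn).
have a0 := a_gt0 x0; have xa0 : 0 < x * a x by rewrite mulr_gt0.
set r := Num.sqrt (x * a x).
have r0 : 0 < r by rewrite sqrtr_gt0.
have rr : r ^+ 2 = x * a x by rewrite sqr_sqrtr// ltW.
have ra : r / a x = r^-1 * x.
  have -> : a x = r ^+ 2 / x by rewrite rr; field; rewrite gt_eqF.
  by field; rewrite !gt_eqF.
rewrite /arrival; set H := \sum_(i < n.+1) X i w.
set A := \sum_(i < n.+1) (x - i%:R) * X i w.
have -> : \sum_(i < n.+1) r^-1 * weight t1 t2 x i * X i w = r^-1 * (t1 * H + t2 / x * A).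
  rewrite /H /A !mulr_sumr -big_split/= mulr_sumr; apply: eq_bigr => i _.
  by rewrite /weight; field; rewrite !gt_eqF.
transitivity (r / a x * (t1 * (H / x - m) + t2 * (A / x ^+ 2 - 1 / 2 * m))).
  by field; rewrite !gt_eqF.
by rewrite ra; field; rewrite !gt_eqF.
Qed.

(** [L] is half the quadratic form of [covC s] at [(t1, t2)]; it is the Riemann
limit found in [cumulant_approx]. *)
Lemma scaled_pair_mgf t1 t2 e : 0 < e ->
  let L := s / 2 * (t1 ^+ 2 + t1 * t2 + t2 ^+ 2 / 3) in
  \forall x \near +oo,
  ((expR ((L - e) / a x))%:E
    <= \int[P]_w (expR ((t1 * Z1 x w + t2 * Z2 x w) / a x))%:E
    <= (expR ((L + e) / a x))%:E)%E.
Proof.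
move=> e0 L.
have [Mphi phiP] := log_mgf_expansion (X_gt0 0) phi_dom0.
have [r /= r0 rP] : exists2 r : R, 0 < r & forall b : R, `|b| < r ->
    'M_P (X 0%N) b = (expR (log_mgf_real (X 0%N) b))%:E.
  have /nbhs_ballP[r r0 rP] := Mphi.
  by exists r => // b br; apply: rP; rewrite /ball/= sub0r normrN.
near=> x.
have x0 : 0 < x by near: x; exact: nbhs_pinfty_gt.
have a0 := a_gt0 x0.
have [n [nx xn]] := exists_nat_ceil x0.
have small : forall i : nat, i%:R < x -> `|c x * weight t1 t2 x i| < r.
  by near: x; exact: small_weight.
have approx : `|a x * (\sum_(i < n.+1) log_mgf_real (X 0%N) (c x * weight t1 t2 x i)
      - c x * x * (m * (t1 + t2 / 2))) - L| <= e.
  move: n nx xn; near: x.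
  exact: (cumulant_approx a_gt0 a_to0 xa_toy t1 t2 (ltW s_gt0) phiP e0).
set C := c x * x * (m * (t1 + t2 / 2)) in approx.
(* Padding by [0], so that every coefficient lies where the moment generating
   function is finite. *)
pose b i := if (i < n.+1)%N then c x * weight t1 t2 x i else 0.
have bE (i : 'I_n.+1) : b i = c x * weight t1 t2 x i by rewrite /b ltn_ord.
have br i : `|b i| < r.
  rewrite /b; case: ltnP => // [ilt|_]; last by rewrite normr0.
  by apply: small; rewrite (le_lt_trans _ nx)// ler_nat -ltnS.
have -> : (\int[P]_w (expR ((t1 * Z1 x w + t2 * Z2 x w) / a x))%:E =
    (expR (\sum_(i < n.+1) log_mgf_real (X 0%N) (c x * weight t1 t2 x i) - C))%:E)%E.
  transitivity (\int[P]_w ((expR (- C))%:E * (expR (\sum_(i < n.+1) b i * X i w))%:E))%E.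
    apply: eq_integral => w _; rewrite (scaled_pair_linear t1 t2 w x0 nx xn).
    have -> : \sum_(i < n.+1) c x * weight t1 t2 x i * X i w =
        \sum_(i < n.+1) b i * X i w.
      by apply: eq_bigr => i _; rewrite bE.
    by rewrite -/C addrC expRD EFinM.
  rewrite ge0_integralZl//; last first.
    apply/measurable_EFinP; apply: measurableT_comp => //; apply: measurable_sum => i.
    exact: measurable_funM.
  rewrite mmt_gen_fun_wsum//; last by move=> i; rewrite rP// ltry.
  rewrite (eq_bigr (fun i : 'I_n.+1 =>
      (expR (log_mgf_real (X 0%N) (c x * weight t1 t2 x i)))%:E)); last first.
    by move=> i _; rewrite rP// bE.
  rewrite prodEFin -EFinM -expR_sum -expRD addrC//.
rewrite !lee_fin !ler_expR; set U := (_ - C) in approx *.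
have UE : U = a x * U / a x by field; rewrite gt_eqF.
rewrite UE !ler_pM2r ?invr_gt0//.
by move: approx; rewrite ler_norml => /andP[? ?]; apply/andP; split; lra.
Unshelve. all: end_near. Qed.

Let q := Num.sqrt s.
Let k := Num.sqrt (3 : R).
(** Coordinates in which the covariance matrix is the identity and the rate function
is half the squared Euclidean norm. *)
Let Y1 x w := Z1 x w / q.
Let Y2 x w := k * (Z1 x w - 2 * Z2 x w) / q.

Let q0 : 0 < q. Proof. by rewrite sqrtr_gt0. Qed.
Let qq : q ^+ 2 = s. Proof. by rewrite sqr_sqrtr// ltW. Qed.
Let k0 : 0 < k. Proof. by rewrite sqrtr_gt0. Qed.
Let kk : k ^+ 2 = 3. Proof. by rewrite sqr_sqrtr. Qed.

Lemma quad_norm x w : quad s (Z x w) = (Y1 x w ^+ 2 + Y2 x w ^+ 2) / 2.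
Proof.
rewrite /quad -/(Z1 x w) -/(Z2 x w) /Y1 /Y2 !expr_div_n !exprMn kk qq.
by field; rewrite gt_eqF.
Qed.

Lemma mgf_Y u1 u2 e : 0 < e -> \forall x \near +oo,
  ((expR (((u1 ^+ 2 + u2 ^+ 2) / 2 - e) / a x))%:E
    <= \int[P]_w (tilt Y1 Y2 a u1 u2 0 x w)%:E
    <= (expR (((u1 ^+ 2 + u2 ^+ 2) / 2 + e) / a x))%:E)%E.
Proof.
move=> e0.
have linE x w : (u1 + k * u2) / q * Z1 x w + - (2 * k * u2) / q * Z2 x w =
    u1 * Y1 x w + u2 * Y2 x w - 0.
  by rewrite /Y1 /Y2; field; rewrite gt_eqF.
have := scaled_pair_mgf ((u1 + k * u2) / q) (- (2 * k * u2) / q) e0.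
apply: filterS => x.
have -> : s / 2 * (((u1 + k * u2) / q) ^+ 2 +
    (u1 + k * u2) / q * (- (2 * k * u2) / q) + (- (2 * k * u2) / q) ^+ 2 / 3)
    = (u1 ^+ 2 + u2 ^+ 2) / 2.
  rewrite -qq.
  transitivity ((u1 ^+ 2 + k ^+ 2 * u2 ^+ 2 / 3) / 2); first by field; rewrite gt_eqF.
  by rewrite kk; field.
by under eq_integral => w _ do rewrite linE.
Qed.

Let mY x : 0 < x -> measurable_fun setT (Y1 x) /\ measurable_fun setT (Y2 x).
Proof.
move=> x0; have [m1 m2] := measurable_scaled_pair x0; split.
  exact: measurable_funM.
apply: measurable_funM => //; apply: measurable_funM => //.
by apply: measurable_funB => //; exact: measurable_funM.
Qed.
Let mY1 x (x0 : 0 < x) := (mY x0).1.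
Let mY2 x (x0 : 0 < x) := (mY x0).2.

Lemma scaled_pair_random_vector x : 0 < x -> random_vector (Z x).
Proof. by move=> /measurable_scaled_pair[? ?]; exact: random_vector2. Qed.

(** A closed set on which the rate is at least [J] lies outside the disc of squared
radius [2 * J]; letting [J] increase covers an infinite infimum, that of the empty
set. *)
Lemma scaled_pair_upper (C : set 'rV[R]_2) : closed C ->
  (limf_esup (fun x : R => ((1 / a x)^-1)%:E * lne (P (Z x @^-1` C))) +oo%R
    <= - ereal_inf (psi_star s @` C))%E.
Proof.
move=> clC; set I := ereal_inf _.
have I0 : (0 <= I)%E.
  by apply: le_ereal_inf_tmp => _ [z _ <-]; rewrite psi_starE// lee_fin quad_ge0.
have bound (J e : R) : 0 <= J -> (J%:E <= I)%E -> 0 < e ->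
    (limf_esup (fun x : R => ((1 / a x)^-1)%:E * lne (P (Z x @^-1` C))) +oo%R
      <= (- J + e)%:E)%E.
  move=> J0 JI e0; apply: limf_esup_le_near.
  near=> x; have x0 : 0 < x by near: x; exact: nbhs_pinfty_gt.
  have mC : measurable (Z x @^-1` C).
    apply: scaled_pair_random_vector => //.
    rewrite -[C]setCK; apply: sigma_algebraC; apply: sub_sigma_algebra.
    exact: closed_openC.
  rewrite div1r invrK; apply: lne_le_expR => //; first exact: a_gt0.
  apply: (@le_trans _ _ (P [set w | (2 * J <= Y1 x w ^+ 2 + Y2 x w ^+ 2)%R])); last first.
    by near: x; exact: (upper_tail mY1 mY2 a_gt0 a_to0 mgf_Y).
  apply: le_measure; rewrite ?inE//; first exact: measurable_tail.
  move=> w /= Cw.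
  have : (J%:E <= psi_star s (Z x w))%E.
    by apply: (le_trans JI); apply: ereal_inf_lbound; exists (Z x w).
  by rewrite psi_starE// lee_fin quad_norm ler_pdivlMr// mulrC.
case: (I) I0 bound => [J||] J0 bound //.
  apply/lee_addgt0Pr => e e0; rewrite -EFinN -EFinD.
  exact: bound.
rewrite leeNr leye_eq; apply/eqP/eqyP => A A0; rewrite leeNr -EFinN.
have -> : - A = - (A + 1) + 1 by ring.
by apply: bound; rewrite ?leey// addr_ge0// ltW.
Unshelve. all: end_near. Qed.

(** An open set contains, around each of its points, a box in the coordinates
[(Y1, Y2)]. *)
Lemma scaled_pair_lower (O : set 'rV[R]_2) : open O ->
  (- ereal_inf (psi_star s @` O)
    <= limf_einf (fun x : R => ((1 / a x)^-1)%:E * lne (P (Z x @^-1` O))) +oo%R)%E.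
Proof.
move=> oO; rewrite leeNl; apply: le_ereal_inf_tmp => _ [z Oz <-].
rewrite leeNl psi_starE// -EFinN; apply/lee_subgt0Pr => e e0.
rewrite -EFinB; apply: limf_einf_ge_near.
pose y1 := z 0 0 / q; pose y2 := k * (z 0 0 - 2 * z 0 1) / q.
have /nbhs_ballP[r /= r0 rO] : nbhs z O by exact: open_nbhs_nbhs.
(* From [|z2| <= (|z1| + |z1 - 2 z2|) / 2], this radius in the coordinates
   [(Y1, Y2)] keeps both original coordinates within [r]. *)
pose dl := Num.min (r / q) (r / q * (k / (1 + k))).
have rq0 : 0 < r / q by rewrite divr_gt0.
have k10 : 0 < 1 + k by rewrite addr_gt0.
have dl0 : 0 < dl by rewrite lt_min rq0 mulr_gt0// divr_gt0.
have dl1 : dl <= r / q by rewrite ge_min lexx.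
have dl2 : dl * (1 + k) <= r / q * k.
  have : dl <= r / q * (k / (1 + k)) by rewrite ge_min lexx orbT.
  by rewrite [r / q * (k / (1 + k))]mulrA ler_pdivlMr.
near=> x; have x0 : 0 < x by near: x; exact: nbhs_pinfty_gt.
have mO : measurable (Z x @^-1` O).
  by apply: scaled_pair_random_vector => //; exact: sub_sigma_algebra.
rewrite div1r invrK; apply: lne_ge_expR => //; first exact: a_gt0.
apply: (@le_trans _ _ (P [set w | (`|Y1 x w - y1| < dl)%R /\ (`|Y2 x w - y2| < dl)%R])).
  have -> : - quad s z - e = - ((y1 ^+ 2 + y2 ^+ 2) / 2 + e).
    rewrite /quad /y1 /y2 !expr_div_n !exprMn kk qq.
    by field; rewrite gt_eqF.
  by near: x; exact: (lower_box mY1 mY2 a_gt0 a_to0 mgf_Y).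
apply: le_measure; rewrite ?inE//; first exact: measurable_box.
move=> w /= [w1 w2]; apply: rO.
move: w1 w2; rewrite /Y1 /Y2 /y1 /y2 -!mulrBl.
have qn : `|q^-1| = q^-1 by rewrite gtr0_norm ?invr_gt0.
rewrite -mulrBr !normrM !qn (gtr0_norm k0).
rewrite !ltr_pdivrMr// => w1 w2.
have dq1 : dl * q <= r by rewrite -ler_pdivlMr.
have dq2 : dl * q * (1 + k) <= r * k.
  by rewrite mulrAC -ler_pdivlMr// mulrAC.
apply: mx_ball2 => //; first exact: lt_le_trans w1 dq1.
set D1 := _ - _ in w1; set D2 := Z x w 0 1 - z 0 1.
have DE : Z1 x w - 2 * Z2 x w - (z 0 0 - 2 * z 0 1) = D1 - 2 * D2.
  by rewrite /D1 /D2 /Z1 /Z2; ring.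
rewrite DE in w2.
have n2 : 2 * `|D2| <= `|D1| + `|D1 - 2 * D2|.
  have -> : 2 * `|D2| = `|D1 - (D1 - 2 * D2)|.
    by rewrite opprB addrCA subrr addr0 normrM ger0_norm.
  exact: ler_normB.
suff : k * (2 * `|D2|) < k * (2 * r) by rewrite ltr_pM2l// ltr_pM2l.
apply: (@le_lt_trans _ _ (k * `|D1| + k * `|D1 - 2 * D2|)).
  by rewrite -mulrDr ler_pM2l.
apply: (@lt_le_trans _ _ (k * (dl * q) + dl * q)).
  by apply: ltrD => //; rewrite ltr_pM2l.
have : 0 <= k * r by rewrite mulr_ge0// ltW.
by lra.
Unshelve. all: end_near. Qed.

Lemma scaled_pair_LDP : LDP P Z (fun x => 1 / a x) (psi_star s).
Proof.
split.
- exact: scaled_pair_random_vector.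
- apply/cvgryPgt => A.
  pose B := Num.max A 1.
  have B0 : 0 < B by rewrite lt_max ltr01 orbT.
  near=> x.
  have x0 : 0 < x by near: x; exact: nbhs_pinfty_gt.
  have a0 := a_gt0 x0.
  apply: (@le_lt_trans _ _ B); first by rewrite le_max lexx.
  rewrite ltr_pdivlMr// mulrC -ltr_pdivlMr//.
  by near: x; apply: (cvgr_lt _ a_to0); rewrite divr_gt0.
- by have [] := good_rate_psi_star s_gt0.
- exact: scaled_pair_upper.
- exact: scaled_pair_lower.
Unshelve. all: end_near. Qed.

End ScaledPair.

Theorem proposition4p1 (R : realType) (d : measure_display)
  (Omega : measurableType d) (P : probability Omega R)
  (X : nat -> {RV P >-> R})
  (X_iid : iid X)
  (X_gt0 : forall (n : nat) (w : Omega), 0 < X n w)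
  (phi_dom0 : interior (log_mgf_dom (X 0%N)) 0)
  (phi''_gt0 : 0 < log_mgf''0 (X 0%N))
  (a : R -> R)
  (a_gt0 : forall x : R, 0 < x -> 0 < a x)
  (a_to0 : a x @[x --> +oo] --> (0 : R))
  (xa_toy : x * a x @[x --> +oo] --> +oo) :
  [/\ covC (log_mgf''0 (X 0%N)) \in unitmx,
      invmx (covC (log_mgf''0 (X 0%N))) = hatC (log_mgf''0 (X 0%N)),
      good_rate_function (psi_star (log_mgf''0 (X 0%N))) &
      LDP P (scaled_pair (fun n => X n : Omega -> R) (log_mgf'0 (X 0%N)) a)
        (fun x => 1 / a x) (psi_star (log_mgf''0 (X 0%N)))].
Proof.
have CH := covC_mul phi''_gt0.
have [uC _] := mulmx1_unit CH.
split => //.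
- by rewrite -[RHS]mul1mx -(mulVmx uC) -mulmxA CH mulmx1.
- exact: good_rate_psi_star.
- exact: scaled_pair_LDP.
Qed.
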